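(* Let $(H,\Delta)$ be a compact quantum group and $\delta$ a free coaction of $H$ on a unital $C^*$-algebra $A$. Suppose there is a character $\phi$ on the equivariant join $A\circledast^\delta H$. Then the following hold. (1) At least one of $A$ or $H$ admits a character. (2) If $H$ admits a character, then there is a continuous path of characters on $A\circledast^\delta H$ connecting $\phi$ to a character of the form $\rho\circ\mathrm{ev}_1$, where $\rho$ is a character on $\mathbb{C}\otimes H\cong H$. (3) If $A$ admits a character, then there is a continuous path of characters on $A\circledast^\delta H$ connecting $\phi$ to a character of the form $\rho\circ\mathrm{ev}_0$, where $\rho$ is a character on $\delta(A)\cong A$.
   Context: All tensor products of $C^*$-algebras are minimal. A character on a unital $C^*$-algebra is a unital $*$-homomorphism to $\mathbb{C}$; paths of characters are continuous for the topology of pointwise convergence. A coaction $\delta:A\to A\otimes H$ is free if it is injective and the closed linear span of $\{(a\otimes 1)\delta(b):a,b\in A\}$ is $A\otimes H$. The equivariant join is $A \circledast^{\delta} H := \{f\in C([0,1],A\otimes H): f(0)\in\delta(A),\ f(1)\in\mathbb{C}\otimes H\}$, and $\mathrm{ev}_t$ is evaluation at $t\in[0,1]$. *)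

(* Defs.v *)
From HB Require Import structures.
From mathcomp Require Import all_boot all_order all_algebra.
From mathcomp Require Import all_classical all_reals all_analysis.
From mathcomp Require Import complex lra.

Set Implicit Arguments.
Unset Strict Implicit.
Unset Printing Implicit Defensive.

Import Order.TTheory GRing.Theory Num.Theory.
Import numFieldNormedType.Exports.
Import ComplexField.

Local Open Scope classical_set_scope.
Local Open Scope complex_scope.
Local Open Scope ring_scope.

HB.mixin Record Algebra_isStar (R : realType) A of GRing.Algebra R[i] A := {
  star : A -> A;
  starK : involutive star;
  starD : {morph star : x y / x + y};
  starZ : forall (c : R[i]) (x : A), star (c *: x) = Num.conj c *: star x;
  starM : forall x y : A, star (x * y) = star y * star x
}.

#[short(type="starAlgType")]
HB.structure Definition StarAlgebra (R : realType) :=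
  {A of GRing.Algebra R[i] A & Algebra_isStar R A}.

(* Unital C*-algebras over R[i].  The norm is a field of the mixin, and not
   [Num.norm]: the hierarchy has no join of (noncommutative) rings and normed
   modules below [numDomainType].  The topology is that of the norm, by
   [cnorm_entourageE]; completeness is [cauchy_cvg_to].  As everywhere in the
   ring hierarchy, 1 != 0. *)
HB.mixin Record Star_isCStar (R : realType) A
    of StarAlgebra R A & Uniform A := {
  cnorm : A -> R;
  cnorm_entourageE : @entourage A = entourage_ (ball_ cnorm);
  cauchy_cvg_to : forall F : set_system A, ProperFilter F -> cauchy F ->
    exists x : A, F --> x;
  cnormD_le : forall x y : A, cnorm (x + y) <= cnorm x + cnorm y;
  cnormZ : forall (c : R[i]) (x : A), cnorm (c *: x) = Normc.normc c * cnorm x;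
  cnorm0_eq0 : forall x : A, cnorm x = 0 -> x = 0;
  cnormM_le : forall x y : A, cnorm (x * y) <= cnorm x * cnorm y;
  cnorm_starM : forall x : A, cnorm (star x * x) = cnorm x ^+ 2
}.

#[short(type="cstarAlgType")]
HB.structure Definition CStarAlgebra (R : realType) :=
  {A of StarAlgebra R A & Uniform A & Star_isCStar R A}.

HB.mixin Record isHilbert (R : realType) V of CompleteNormedModule R[i] V := {
  inner : V -> V -> R[i];
  innerDl : forall x y z : V, inner (x + y) z = inner x z + inner y z;
  innerZl : forall (c : R[i]) (x y : V), inner (c *: x) y = c * inner x y;
  innerC : forall x y : V, inner y x = Num.conj (inner x y);
  inner_norm : forall x : V, inner x x = `|x| ^+ 2
}.

#[short(type="hilbertType")]
HB.structure Definition Hilbert (R : realType) :=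
  {V of CompleteNormedModule R[i] V & isHilbert R V}.

Section regular_star.
Variable R : realType.
Notation C := R[i].

Let conjK : involutive (Num.conj : C^o -> C^o).
Proof. exact: conjCK. Qed.
Let conjD : {morph (Num.conj : C^o -> C^o) : x y / x + y}.
Proof. by move=> x y; exact: rmorphD. Qed.
Let conjZ (c : C) (x : C^o) : Num.conj (c *: x) = Num.conj c *: Num.conj x.
Proof. exact: rmorphM. Qed.
Let conjM (x y : C^o) : Num.conj (x * y) = Num.conj y * Num.conj x :> C^o.
Proof. by rewrite rmorphM mulrC. Qed.

HB.instance Definition _ :=
  Algebra_isStar.Build R C^o conjK conjD conjZ conjM.
End regular_star.

Section fct_star.
Variables (R : realType) (T : pointedType) (B : starAlgType R).
Implicit Types f g : T -> B.

Let scalerAlT (c : R[i]) f g : c *: (f * g) = (c *: f) * g.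
Proof. by apply/funext => x; exact: scalerAl. Qed.
HB.instance Definition _ :=
  GRing.Lmodule_isLalgebra.Build R[i] (T -> B) scalerAlT.
Let scalerArT (c : R[i]) f g : c *: (f * g) = f * (c *: g).
Proof. by apply/funext => x; exact: scalerAr. Qed.
HB.instance Definition _ :=
  GRing.Lalgebra_isAlgebra.Build R[i] (T -> B) scalerArT.

Let starT f : T -> B := fun x => star (f x).
Let starTK : involutive starT.
Proof. by move=> f; apply/funext => x; exact: starK. Qed.
Let starTD : {morph starT : f g / f + g}.
Proof. by move=> f g; apply/funext => x; exact: starD. Qed.
Let starTZ (c : R[i]) f : starT (c *: f) = Num.conj c *: starT f.
Proof. by apply/funext => x; exact: starZ. Qed.
Let starTM f g : starT (f * g) = starT g * starT f.
Proof. by apply/funext => x; exact: starM. Qed.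
HB.instance Definition _ :=
  Algebra_isStar.Build R (T -> B) starTK starTD starTZ starTM.
End fct_star.

Record starSubalgebra (R : realType) (B : starAlgType R) := StarSubalgebra {
  starsub_set : set B;
  starsub1 : starsub_set 1;
  starsubD : forall x y, starsub_set x -> starsub_set y -> starsub_set (x + y);
  starsubZ : forall (c : R[i]) x, starsub_set x -> starsub_set (c *: x);
  starsubM : forall x y, starsub_set x -> starsub_set y -> starsub_set (x * y);
  starsubS : forall x, starsub_set x -> starsub_set (star x)
}.

Section starsub.
Variables (R : realType) (B : starAlgType R) (S : starSubalgebra B).

Definition starsub_pred : {pred B} := [pred x | x \in starsub_set S].

Let subalg : subalg_closed starsub_pred.
Proof.
split=> [|c u v|u v]; rewrite !inE.
- exact: starsub1.
- by move=> uS vS; apply: starsubD => //; exact: starsubZ.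
- exact: starsubM.
Qed.
HB.instance Definition _ := GRing.isSubalgClosed.Build R[i] B starsub_pred subalg.

Definition starsub_type : Type := {x : B | x \in starsub_pred}.
HB.instance Definition _ := SubChoice.on starsub_type.
HB.instance Definition _ :=
  GRing.SubChoice_isSubAlgebra.Build R[i] B starsub_pred starsub_type subalg.

Let starS (u : starsub_type) : starsub_type :=
  exist _ (star (val u)) (mem_set (starsubS (set_mem (valP u)))).
Let starSK : involutive starS.
Proof. by move=> u; apply: val_inj; exact: starK. Qed.
Let starSD : {morph starS : u v / u + v}.
Proof. by move=> u v; apply: val_inj; exact: starD. Qed.
Let starSZ (c : R[i]) u : starS (c *: u) = Num.conj c *: starS u.
Proof. by apply: val_inj; exact: starZ. Qed.
Let starSM u v : starS (u * v) = starS v * starS u.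
Proof. by apply: val_inj; exact: starM. Qed.
HB.instance Definition _ :=
  Algebra_isStar.Build R starsub_type starSK starSD starSZ starSM.

End starsub.

Coercion starsub_type : starSubalgebra >-> Sortclass.

Section morphisms.
Variable R : realType.

Record unital_star_hom (A B : starAlgType R) (f : A -> B) : Prop := {
  starhom_linear : linear f;
  starhom1 : f 1 = 1;
  starhomM : {morph f : x y / x * y};
  starhomS : {morph f : x / star x}
}.

Definition character (A : starAlgType R) (f : A -> R[i]^o) : Prop :=
  unital_star_hom f.

Definition span (V : lmodType R[i]) (X : set V) : set V :=
  [set v | exists2 s : seq (R[i] * V), (forall p, p \in s -> X p.2) &
           v = \sum_(p <- s) p.1 *: p.2].

End morphisms.

Section minimal_tensor.
Variable R : realType.

(* Unital *-representations by bounded operators. *)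
Record representation (A : starAlgType R) (K : hilbertType R)
    (pi : A -> K -> K) : Prop := {
  rep_linear : forall a, linear (pi a);
  rep_continuous : forall a, continuous (pi a);
  repD : forall a b x, pi (a + b) x = pi a x + pi b x;
  repZ : forall (c : R[i]) a x, pi (c *: a) x = c *: pi a x;
  rep1 : forall x, pi 1 x = x;
  repM : forall a b x, pi (a * b) x = pi a (pi b x);
  repS : forall a x y, inner (pi a x) y = inner x (pi (star a) y)
}.

(* A sequence y of pairs stands for the sum of the elementary tensors
   p.1 (x) p.2, and this is the squared norm of that sum in the Hilbert space
   tensor product of K and L. *)
Definition tensor_sqnorm (K L : hilbertType R) (y : seq (K * L)) : R[i] :=
  \sum_(p <- y) \sum_(q <- y) inner p.1 q.1 * inner p.2 q.2.

(* The image of the sum y under (pi (x) sigma)(x), as a sum of elementary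
   tensors. *)
Definition tensor_act (A B : Type) (K L : hilbertType R) (pi : A -> K -> K)
    (sigma : B -> L -> L) (x : seq (A * B)) (y : seq (K * L)) : seq (K * L) :=
  [seq (pi p.1 q.1, sigma p.2 q.2) | p <- x, q <- y].

(* M bounds the operator norm of (pi (x) sigma)(x) on the Hilbert space tensor
   product of K and L, for all representations pi and sigma: the algebraic
   tensor product of K and L is dense there, so that finite sums y suffice.
   The minimal (spatial) norm of x is the least such M. *)
Definition spatial_bound (A B : starAlgType R) (x : seq (A * B)) (M : R) :
    Prop :=
  0 <= M /\
  forall (K L : hilbertType R) (pi : A -> K -> K) (sigma : B -> L -> L),
    representation pi -> representation sigma ->
    forall y : seq (K * L),
      tensor_sqnorm (tensor_act pi sigma x y) <= (M ^+ 2)%:C * tensor_sqnorm y.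

(* A minimal tensor product of A and B: a C*-algebra with a *-bilinear map
   whose values span a dense *-subalgebra, on which the norm is the minimal
   one.  This determines the algebra up to a unique isomorphism that respects
   elementary tensors.  The algebraic tensor product embeds, because the
   minimal norm is a norm on it. *)
Record minTensor (A B : cstarAlgType R) := MinTensor {
  tensor_alg :> cstarAlgType R;
  tensor : A -> B -> tensor_alg;
  tensor_linearl : forall b, linear (tensor^~ b);
  tensor_linearr : forall a, linear (tensor a);
  tensor1 : tensor 1 1 = 1;
  tensorM : forall a a' b b',
    tensor a b * tensor a' b' = tensor (a * a') (b * b');
  tensorS : forall a b, star (tensor a b) = tensor (star a) (star b);
  tensor_dense :
    closure (span [set tensor a b | a in setT & b in setT]) = setT;
  tensor_norm_bound : forall x : seq (A * B),
    spatial_bound x (cnorm (\sum_(p <- x) tensor p.1 p.2));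
  tensor_norm_least : forall (x : seq (A * B)) (M : R),
    spatial_bound x M -> cnorm (\sum_(p <- x) tensor p.1 p.2) <= M
}.

(* F is f (x) g. *)
Definition tensor_hom (A A' B B' : cstarAlgType R) (AB : minTensor A B)
    (AB' : minTensor A' B') (f : A -> A') (g : B -> B') (F : AB -> AB') :
    Prop :=
  [/\ unital_star_hom F, continuous F &
      forall a b, F (tensor AB a b) = tensor AB' (f a) (g b)].

(* F is the canonical isomorphism from A (x) (B (x) D) to (A (x) B) (x) D. *)
Definition tensor_assoc (A B D : cstarAlgType R) (AB : minTensor A B)
    (AB_D : minTensor AB D) (BD : minTensor B D) (A_BD : minTensor A BD)
    (F : A_BD -> AB_D) : Prop :=
  [/\ unital_star_hom F, continuous F &
      forall a b d, F (tensor A_BD a (tensor BD b d)) =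
                    tensor AB_D (tensor AB a b) d].

(* (delta (x) id) o delta = (id (x) Delta) o delta.  The three maps that are
   quantified here always exist, and are unique because elementary tensors
   span dense subspaces. *)
Definition coassociative (A H : cstarAlgType R) (AH : minTensor A H)
    (HH : minTensor H H) (AH_H : minTensor AH H) (A_HH : minTensor A HH)
    (delta : A -> AH) (Delta : H -> HH) : Prop :=
  exists (delta_id : AH -> AH_H) (id_Delta : AH -> A_HH) (alpha : A_HH -> AH_H),
  [/\ tensor_hom delta id delta_id, tensor_hom id Delta id_Delta,
      tensor_assoc alpha & delta_id \o delta = alpha \o id_Delta \o delta].

End minimal_tensor.

Section quantum_group.
Variable R : realType.

(* Compact quantum groups in the sense of Woronowicz, with a choice of the
   minimal tensor products that the axioms mention. *)
Record compactQuantumGroup := CompactQuantumGroup {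
  cqg_alg :> cstarAlgType R;
  cqg_HH : minTensor cqg_alg cqg_alg;
  cqg_HH_H : minTensor cqg_HH cqg_alg;
  cqg_H_HH : minTensor cqg_alg cqg_HH;
  comul : cqg_alg -> cqg_HH;
  comul_hom : unital_star_hom comul;
  comul_coassoc : coassociative cqg_HH_H cqg_H_HH comul comul;
  comul_cancell : closure (span
    [set tensor cqg_HH a 1 * comul b | a in setT & b in setT]) = setT;
  comul_cancelr : closure (span
    [set tensor cqg_HH 1 a * comul b | a in setT & b in setT]) = setT
}.

(* Injectivity is not part of the definition of a coaction; the density
   condition [coact_counital] is. *)
Record coaction (A : cstarAlgType R) (G : compactQuantumGroup) := Coaction {
  coact_AH : minTensor A G;
  coact_AH_H : minTensor coact_AH G;
  coact_A_HH : minTensor A (cqg_HH G);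
  coact :> A -> coact_AH;
  coact_hom : unital_star_hom coact;
  coact_coassoc : coassociative coact_AH_H coact_A_HH coact (@comul G);
  coact_counital : closure (span
    [set coact a * tensor coact_AH 1 h | a in setT & h in setT]) = setT
}.

Definition free_coaction (A : cstarAlgType R) (G : compactQuantumGroup)
    (delta : coaction A G) : Prop :=
  injective delta /\
  closure (span
    [set tensor (coact_AH delta) a 1 * delta b | a in setT & b in setT]) = setT.

End quantum_group.

Section unit_interval.
Variable R : realType.

Definition I01 : Type := `[0%R, 1%R]%classic : set R.
HB.instance Definition _ := Topological.on I01.

Fact I01_0_subproof : (0 : R) \in `[0%R, 1%R]%classic.
Proof. by rewrite inE /= in_itv /= lexx ler01. Qed.
Fact I01_1_subproof : (1 : R) \in `[0%R, 1%R]%classic.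
Proof. by rewrite inE /= in_itv /= lexx ler01. Qed.

Definition I0 : I01 := exist _ 0 I01_0_subproof.
Definition I1 : I01 := exist _ 1 I01_1_subproof.
HB.instance Definition _ := isPointed.Build I01 I0.

End unit_interval.
Arguments I0 {R}.
Arguments I1 {R}.

Section cstar_continuity.
Variables (R : realType) (A : cstarAlgType R).
Implicit Types x y : A.

Lemma cnorm0 : cnorm (0 : A) = 0.
Proof. by rewrite -(scale0r (0 : A)) cnormZ Normc.normc0 mul0r. Qed.

Lemma cnormN x : cnorm (- x) = cnorm x.
Proof. by rewrite -scaleN1r cnormZ normcN Normc.normc1 mul1r. Qed.

Lemma cnorm_ge0 x : 0 <= cnorm x.
Proof.
have := cnormD_le x (- x); rewrite subrr cnorm0 cnormN -mulr2n.
by rewrite pmulrn_lge0.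
Qed.

Lemma cnorm_star x : cnorm (star x) = cnorm x.
Proof.
suff le y : cnorm y <= cnorm (star y).
  by apply/eqP; rewrite eq_le le andbT -{2}(starK x) le.
have [->|y0] := eqVneq (cnorm y) 0; first exact: cnorm_ge0.
have y_gt0 : 0 < cnorm y by rewrite lt_def y0 cnorm_ge0.
by rewrite -(ler_pM2r y_gt0) -expr2 -cnorm_starM cnormM_le.
Qed.

Lemma nbhs_cnormP (x : A) (U : set A) :
  nbhs x U <-> exists2 e : R, 0 < e & ball_ (@cnorm R A) x e `<=` U.
Proof.
rewrite -nbhs_entourageE cnorm_entourageE; split.
  move=> [E [e e0 eE] EU]; exists e => // y xy.
  by apply: EU; apply/xsectionP; exact: eE.
move=> [e e0 eU]; exists [set xy | ball_ (@cnorm R A) xy.1 e xy.2].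
  by exists e.
by move=> y /xsectionP; exact: eU.
Qed.

Lemma cnorm_cvgP (T : topologicalType) (f : T -> A) (t : T) :
  {for t, continuous f} <->
  forall e : R, 0 < e -> \forall s \near t, cnorm (f t - f s) < e.
Proof.
split=> [cf e e0|cf U /nbhs_cnormP[e e0 eU]].
  by apply: (cf (ball_ (@cnorm R A) (f t) e)); apply/nbhs_cnormP; exists e.
by apply: filterS (cf e e0) => s ?; exact: eU.
Qed.

Section operations.
Variable T : topologicalType.
Implicit Types f g : T -> A.

Lemma cstar_continuousD f g :
  continuous f -> continuous g -> continuous (fun t => f t + g t).
Proof.
move=> cf cg t; apply/cnorm_cvgP => e e0.
have e20 : 0 < e / 2 by rewrite divr_gt0.
near=> s; rewrite opprD addrACA (splitr e).
apply: le_lt_trans (cnormD_le _ _) _; apply: ltrD; near: s.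
  exact: (cnorm_cvgP f t).1 (cf t) _ e20.
exact: (cnorm_cvgP g t).1 (cg t) _ e20.
Unshelve. all: by end_near. Qed.

Lemma cstar_continuousZ (c : R[i]) f :
  continuous f -> continuous (fun t => c *: f t).
Proof.
move=> cf t; apply/cnorm_cvgP => e e0.
have n0 : 0 <= Normc.normc c by case: c => a b; exact: sqrtr_ge0.
have d0 : 0 < e / (Normc.normc c + 1) by rewrite divr_gt0 // ltr_wpDl.
near=> s; rewrite -scalerBr cnormZ.
have fts : cnorm (f t - f s) < e / (Normc.normc c + 1).
  by near: s; exact: (cnorm_cvgP f t).1 (cf t) _ d0.
apply: le_lt_trans (_ : (Normc.normc c + 1) * cnorm (f t - f s) < e).
  by rewrite ler_wpM2r ?cnorm_ge0 // lerDl.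
by rewrite mulrC -ltr_pdivlMr // ltr_wpDl.
Unshelve. all: by end_near. Qed.

Lemma cstar_continuousM f g :
  continuous f -> continuous g -> continuous (fun t => f t * g t).
Proof.
move=> cf cg t; apply/cnorm_cvgP => e e0.
pose a := cnorm (f t); pose b := cnorm (g t).
have a0 : 0 <= a := cnorm_ge0 _; have b0 : 0 <= b := cnorm_ge0 _.
pose d := Num.min 1 (e / (a + b + 1 + 1)).
have k0 : 0 < a + b + 1 + 1 by rewrite ltr_wpDl // !addr_ge0.
have d0 : 0 < d by rewrite lt_min ltr01 divr_gt0.
near=> s.
have fts : cnorm (f t - f s) < d.
  by near: s; exact: (cnorm_cvgP f t).1 (cf t) _ d0.
have gts : cnorm (g t - g s) < d.
  by near: s; exact: (cnorm_cvgP g t).1 (cg t) _ d0.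
have -> : f t * g t - f s * g s =
    f t * (g t - g s) + ((f t - f s) * g t - (f t - f s) * (g t - g s)).
  rewrite -mulrBr opprB addrCA subrr addr0 mulrBr mulrBl.
  by rewrite addrA subrK.
apply: le_lt_trans (cnormD_le _ _) _.
apply: le_lt_trans (lerD (cnormM_le _ _) (cnormD_le _ _)) _.
rewrite cnormN.
apply: le_lt_trans (lerD (lexx _) (lerD (cnormM_le _ _) (cnormM_le _ _))) _.
have d1 : d <= 1 by rewrite ge_min lexx.
have dk : d * (a + b + 1 + 1) <= e.
  by rewrite -ler_pdivlMr // ge_min lexx orbT.
have := cnorm_ge0 (f t - f s); have := cnorm_ge0 (g t - g s).
rewrite -/a -/b; move: (cnorm (f t - f s)) (cnorm (g t - g s)) fts gts.
move=> u v ud vd v0 u0.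
have avd : a * v <= a * d by rewrite ler_wpM2l // ltW.
have ubd : u * b <= d * b by rewrite ler_wpM2r // ltW.
have uvd : u * v <= u by rewrite ler_piMr // (le_trans (ltW vd)).
by lra.
Unshelve. all: by end_near. Qed.

Lemma cstar_continuous_star f :
  continuous f -> continuous (fun t => star (f t)).
Proof.
move=> cf t; apply/cnorm_cvgP => e e0.
near=> s; rewrite -scaleN1r -[- 1](rmorphN1 Num.conj) -starZ scaleN1r -starD.
rewrite cnorm_star; near: s; exact: (cnorm_cvgP f t).1 (cf t) _ e0.
Unshelve. all: by end_near. Qed.

End operations.
End cstar_continuity.

Section image.
Variables (R : realType) (B D : starAlgType R) (f : B -> D).
Hypothesis hf : unital_star_hom f.

Lemma starhomD x y : f (x + y) = f x + f y.
Proof. by have := starhom_linear hf 1 x y; rewrite !scale1r. Qed.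

Lemma starhom0 : f 0 = 0.
Proof. by apply: (addrI (f 0)); rewrite -starhomD !addr0. Qed.

Lemma starhomZ (c : R[i]) x : f (c *: x) = c *: f x.
Proof. by have := starhom_linear hf c x 0; rewrite starhom0 !addr0. Qed.

Let img1 : range f 1.
Proof. by exists 1 => //; exact: starhom1. Qed.
Let imgD x y : range f x -> range f y -> range f (x + y).
Proof. by move=> [u _ <-] [v _ <-]; exists (u + v) => //; exact: starhomD. Qed.
Let imgZ (c : R[i]) x : range f x -> range f (c *: x).
Proof. by move=> [u _ <-]; exists (c *: u) => //; exact: starhomZ. Qed.
Let imgM x y : range f x -> range f y -> range f (x * y).
Proof. by move=> [u _ <-] [v _ <-]; exists (u * v) => //; exact: starhomM. Qed.
Let imgS x : range f x -> range f (star x).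
Proof. by move=> [u _ <-]; exists (star u) => //; exact: starhomS. Qed.

Definition star_image : starSubalgebra D :=
  StarSubalgebra img1 imgD imgZ imgM imgS.

End image.

Lemma star1 (R : realType) (A : starAlgType R) : star (1 : A) = 1.
Proof. by rewrite -[LHS]mulr1 -{2}(starK 1) -starM mulr1 starK. Qed.

Lemma tensor1_hom (R : realType) (A B : cstarAlgType R) (AB : minTensor A B) :
  unital_star_hom (tensor AB 1).
Proof.
split; [exact: tensor_linearr | exact: tensor1 | |].
- by move=> x y; rewrite tensorM mulr1.
- by move=> x; rewrite tensorS star1.
Qed.

Section join.
Variables (R : realType) (A : cstarAlgType R) (G : compactQuantumGroup R).
Variable delta : coaction A G.
Notation AH := (coact_AH delta).

Definition deltaA : starSubalgebra AH := star_image (coact_hom delta).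

Definition C_tensor_H : starSubalgebra AH := star_image (tensor1_hom AH).

(* C([0,1], A (x) H) is a *-algebra of functions from [0,1]; the norm plays no
   role for its characters. *)
Definition join_set : set (I01 R -> AH) :=
  [set f | [/\ continuous f, starsub_set deltaA (f I0) &
               starsub_set C_tensor_H (f I1)]].

Let join1 : join_set 1.
Proof. by split; [exact: cst_continuous | exact: starsub1 | exact: starsub1]. Qed.
Let joinD f g : join_set f -> join_set g -> join_set (f + g).
Proof.
move=> [cf f0 f1] [cg g0 g1]; split; [|exact: starsubD|exact: starsubD].
exact: cstar_continuousD.
Qed.
Let joinZ (c : R[i]) f : join_set f -> join_set (c *: f).
Proof.
move=> [cf f0 f1]; split; [|exact: starsubZ|exact: starsubZ].
exact: cstar_continuousZ.
Qed.
Let joinM f g : join_set f -> join_set g -> join_set (f * g).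
Proof.
move=> [cf f0 f1] [cg g0 g1]; split; [|exact: starsubM|exact: starsubM].
exact: cstar_continuousM.
Qed.
Let joinS f : join_set f -> join_set (star f).
Proof.
move=> [cf f0 f1]; split; [|exact: starsubS|exact: starsubS].
exact: cstar_continuous_star.
Qed.

Definition join : starSubalgebra (I01 R -> AH) :=
  StarSubalgebra join1 joinD joinZ joinM joinS.

Fact ev0_subproof (f : join) : val f I0 \in starsub_pred deltaA.
Proof. by have [_ f0 _] := set_mem (valP f); exact: mem_set. Qed.

Fact ev1_subproof (f : join) : val f I1 \in starsub_pred C_tensor_H.
Proof. by have [_ _ f1] := set_mem (valP f); exact: mem_set. Qed.

Definition ev0 (f : join) : deltaA := exist _ (val f I0) (ev0_subproof f).

Definition ev1 (f : join) : C_tensor_H := exist _ (val f I1) (ev1_subproof f).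

End join.

(* {ptws _ -> _} carries the topology of pointwise convergence. *)
Definition character_path (R : realType) (B : starAlgType R)
    (phi psi : B -> R[i]^o) : Prop :=
  exists gamma : I01 R -> {ptws B -> R[i]^o},
    [/\ continuous gamma, forall t, character (gamma t),
         gamma I0 = phi & gamma I1 = psi].

(* Main.v *)
(* A character phi of the join E is evaluated on the central functions t |-> q t
   to find the point t0 = phi(t) of [0, 1] over which phi lives.  If f(t0) = 0,
   then phi f = 0: otherwise one can scale to phi f = 1, and multiply f by a
   cutoff supported near t0 to make it small in norm and zero at both endpoints;
   then 1 - f is invertible in E by a Neumann series, but phi (1 - f) = 0.  Hence phi factors through the fibre at t0, which is delta(A),
   C (x) H or A (x) H.  A character rho of A (x) H gives the path rho o ev_t, so
   (2) and (3) remain only when t0 is the wrong endpoint, where a character of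
   delta(A) or of C (x) H must be extended to A (x) H.  Products of characters
   are bounded for the spatial norm, which settles C (x) H.  For delta(A) one
   needs a character e of H with (chi (x) e) o delta = chi for all chi.  The
   characters of H form a compact semigroup under convolution, so there is an
   idempotent e (Ellis); chi |-> (chi (x) e) o delta is idempotent, and injective
   by the density of delta(A)(1 (x) H), hence the identity. *)
Require Import Defs.
From HB Require Import structures.
From mathcomp Require Import all_boot all_order all_algebra.
From mathcomp Require Import all_classical all_reals all_analysis.
From mathcomp Require Import complex lra.

Set Implicit Arguments.
Unset Strict Implicit.
Unset Printing Implicit Defensive.

Import Order.TTheory GRing.Theory Num.Theory.
Import numFieldNormedType.Exports.
Import ComplexField.

Local Open Scope classical_set_scope.
Local Open Scope complex_scope.
Local Open Scope ring_scope.

(** * Complex numbers *)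

Section complex_modulus.
Variable R : realType.
Notation C := R[i].
Notation nc := (@Normc.normc R).
Implicit Types (z w : C) (x e : R).

Lemma normc_ge0 z : 0 <= nc z.
Proof. by case: z => a b; exact: sqrtr_ge0. Qed.

Lemma normrcE z : `|z| = (nc z)%:C.
Proof. by []. Qed.

Lemma normc_real x : nc x%:C = `|x|.
Proof. by rewrite /= expr0n addr0 sqrtr_sqr. Qed.

Lemma normc_triangle z w : nc (z + w) <= nc z + nc w.
Proof. by have := ler_normD z w; rewrite !normrcE -rmorphD lecR. Qed.

(** The norm of [C^o] takes its values in [C], so [cvgrPdist_lt] ranges over complex radii. A radius
    that is positive in the order of [C] has zero imaginary part, which leaves the real ones. *)
Lemma cvg_normcP (T : Type) (F : set_system T) (f : T -> C^o) (z : C^o)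
    {FF : Filter F} :
  f @ F --> z <-> forall e, 0 < e -> \forall t \near F, nc (z - f t) < e.
Proof.
split=> [/cvgrPdist_lt cf e e0|cf].
  have := cf e%:C; rewrite ltcR => /(_ e0).
  by apply: filterS => t; rewrite normrcE ltcR.
apply/cvgrPdist_lt => -[a b]; rewrite ltcE/= => /andP[/eqP -> a0].
by apply: filterS (cf _ a0) => t; rewrite normrcE ltcE/= eqxx.
Qed.

Lemma continuous_normcP (T : topologicalType) (f : T -> C^o) (t : T) :
  {for t, continuous f} <->
  forall e, 0 < e -> \forall s \near t, nc (f t - f s) < e.
Proof. exact: cvg_normcP. Qed.

Lemma normc_Re z : `|complex.Re z| <= nc z.
Proof.
case: z => a b /=; rewrite -sqrtr_sqr ler_sqrt ?addr_ge0 ?sqr_ge0 //.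
by rewrite lerDl sqr_ge0.
Qed.

Lemma normc_Im z : `|complex.Im z| <= nc z.
Proof.
case: z => a b /=; rewrite -sqrtr_sqr ler_sqrt ?addr_ge0 ?sqr_ge0 //.
by rewrite lerDr sqr_ge0.
Qed.

Lemma normc_le_ReIm (a b : R) : nc (a +i* b) <= `|a| + `|b|.
Proof.
have -> : a +i* b = a%:C + 'i%C * b%:C.
  apply/eqP; rewrite eq_complex /=.
  by rewrite !(mul0r, mul1r, mulr0, subr0, addr0, add0r) !eqxx.
apply: le_trans (normc_triangle _ _) _; rewrite Normc.normcM !normc_real.
by rewrite /= expr0n expr1n add0r sqrtr1 mul1r.
Qed.

Lemma closed_disc_closed (z : C^o) (r : R) :
  closed [set w : C^o | nc (w - z) <= r].
Proof.
move=> w cl /=; rewrite leNgt; apply/negP => rw.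
have e0 : 0 < nc (w - z) - r by rewrite subr_gt0.
have : \forall v \near (w : C^o), nc (w - v) < nc (w - z) - r.
  by have [+ _] := @cvg_normcP C^o (nbhs w) id w _; apply.
move=> /cl[v [/= vr wv]].
have := normc_triangle (w - v) (v - z); rewrite addrA subrK => h.
by have := le_lt_trans h (ltr_leD wv vr); rewrite subrK ltxx.
Qed.

(** The disc is a closed subset of the image of a compact square under (a, b) |-> a + ib. *)
Lemma closed_disc_compact (r : R) : compact [set z : C^o | nc z <= r].
Proof.
pose f (p : R * R) : C^o := p.1 +i* p.2.
have cf : continuous f.
  move=> p; apply/cvg_normcP => e e0.
  have e20 : 0 < e / 2 by rewrite divr_gt0.
  near=> q.
  apply: le_lt_trans (normc_le_ReIm _ _) _; rewrite (splitr e); apply: ltrD.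
    near: q; have /cvgrPdist_lt h : (q.1 @[q --> p] --> p.1) by exact: cvg_fst.
    exact: h _ e20.
  near: q; have /cvgrPdist_lt h : (q.2 @[q --> p] --> p.2) by exact: cvg_snd.
  exact: h _ e20.
have ck : compact (f @` (`[- r, r] `*` `[- r, r])).
  apply: continuous_compact; first exact: continuous_subspaceT.
  by apply: compact_setX; exact: segment_compact.
apply: subclosed_compact ck _.
  have := @closed_disc_closed 0 r.
  by congr closed; apply/seteqP; split=> z /=; rewrite subr0.
move=> [a b] /= zr; exists (a, b) => //=; split; rewrite /= in_itv /= -ler_norml.
  exact: le_trans (normc_Re (a +i* b)) zr.
exact: le_trans (normc_Im (a +i* b)) zr.
Unshelve. all: by end_near. Qed.

(** A Cauchy filter contains a ball, hence a compact disc, where it must converge. *)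
Lemma complex_cauchy_cvg (F : set_system C^o) :
  ProperFilter F -> cauchy F -> cvg F.
Proof.
move=> FF cF.
have [z Fz] : exists z : C^o, F (ball z 1) by exact: (cauchyP F).1.
have FD : F [set w : C^o | nc w <= nc z + 1].
  apply: filterS Fz => w; rewrite -ball_normE /= normrcE ltcR => wz.
  rewrite -[w](subKr z); apply: le_trans (normc_triangle _ _) _.
  by rewrite lerD2l normcN ltW.
exact: compact_cauchy_cvg FD (@closed_disc_compact _).
Qed.
End complex_modulus.

(** * Neumann series and the continuity of characters *)

Lemma starhomB (R : realType) (B D : starAlgType R) (f : B -> D) :
  unital_star_hom f -> {morph f : x y / x - y}.
Proof.
move=> hf x y.
by rewrite (starhomD hf) -scaleN1r (starhomZ hf) scaleN1r.
Qed.

Section neumann.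
Variables (R : realType) (A : cstarAlgType R).
Implicit Types (a b c : A) (e : R).

Lemma cnorm_eq0_of_small a : (forall e, 0 < e -> cnorm a <= e) -> a = 0.
Proof.
move=> small; apply: cnorm0_eq0; apply/eqP; rewrite eq_le cnorm_ge0 andbT.
by apply/ler_addgt0Pl => e e0; rewrite addr0; exact: small.
Qed.

Lemma cnormB_sym a b : cnorm (a - b) = cnorm (b - a).
Proof. by rewrite -opprB cnormN. Qed.

Lemma cnorm_cvg_seqP (u : nat -> A) a :
  u @ \oo --> a -> forall e, 0 < e -> \forall n \near \oo, cnorm (a - u n) < e.
Proof.
move=> ua e e0; apply: (ua (ball_ (@cnorm R A) a e)).
by apply/nbhs_cnormP; exists e.
Qed.

(** [c] is a right inverse of [1 - b], the limit of the partial sums [s n] of the Neumann series. A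
    character with value 1 at [b] would turn the equation into z = 1 + z, which is how it gives
    contradictions below. *)
Lemma neumann_inverse b : cnorm b <= 2^-1 -> exists c, c = 1 + b * c.
Proof.
move=> b2; pose s n := iter n (fun x => 1 + b * x) 0.
pose K := cnorm (1 : A); have K0 : 0 <= K := cnorm_ge0 _.
have bx x y : cnorm x <= y -> cnorm (b * x) <= 2^-1 * y.
  move=> xy; apply: le_trans (cnormM_le _ _) _.
  by apply: ler_pM; rewrite ?cnorm_ge0.
(* [2 * K] is the fixed point of x |-> K + x / 2, so the iteration never passes it. *)
have sK k : cnorm (s k) <= 2 * K.
  elim: k => [|k ih] /=; first by rewrite cnorm0 mulr_ge0.
  apply: le_trans (cnormD_le _ _) _; rewrite -/K.
  by move: (bx _ _ ih); lra.
have sD n k : cnorm (s (n + k)%N - s n) <= 2^-1 ^+ n * (2 * K).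
  elim: n => [|n ih]; first by rewrite expr0 mul1r subr0.
  rewrite addSn /= opprD addrACA subrr add0r -mulrBr exprS -mulrA.
  exact: bx.
have small e : 0 < e -> \forall n \near \oo, 2^-1 ^+ n * (2 * K) < e.
  move=> e0; have : 2^-1 ^+ n * (2 * K) @[n --> \oo] --> 0 * (2 * K).
    apply: cvgMr_tmp; apply: (@cvg_expr R).
    by rewrite ger0_norm ?invr_ge0 ?ler0n //; lra.
  rewrite mul0r => /cvgrPdist_lt/(_ _ e0); apply: filterS => n.
  by rewrite sub0r normrN ger0_norm // !mulr_ge0 // exprn_ge0.
have [c sc] : exists c, s @ \oo --> c.
  apply: cauchy_cvg_to; rewrite /cauchy cnorm_entourageE => E [e e0 sE].
  have e20 : 0 < e / 2 by rewrite divr_gt0.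
  have [N _ NP] := small _ e20.
  exists ([set s n | n in [set n | (N <= n)%N]],
          [set s n | n in [set n | (N <= n)%N]]) => /=.
    by split; exists N => // n /= ?; exists n.
  move=> [x y] /= [[n Nn <-] [m Nm <-]]; apply: sE => /=; rewrite /ball_.
  have -> : s n - s m = (s n - s N) - (s m - s N).
    by rewrite opprB addrA subrK.
  apply: le_lt_trans (cnormD_le _ _) _; rewrite cnormN (splitr e).
  have h k : (N <= k)%N -> cnorm (s k - s N) < e / 2.
    move=> Nk; rewrite -(subnKC Nk); apply: le_lt_trans (sD _ _) _.
    exact: (NP N (leqnn N)).
  by apply: ltrD; exact: h.
exists c; apply/eqP; rewrite -subr_eq0; apply/eqP.
apply: cnorm_eq0_of_small => e e0.
have e20 : 0 < e / 2 by rewrite divr_gt0.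
have [N _ NP] := cnorm_cvg_seqP sc e20.
have -> : c - (1 + b * c) = (c - s N.+1) - b * (c - s N).
  by rewrite /= mulrBr opprB !opprD !addrA subrK.
apply: le_trans (cnormD_le _ _) _; rewrite cnormN.
have h1 : cnorm (c - s N.+1) < e / 2 by exact: (NP N.+1 (leqnSn N)).
have h2 : cnorm (c - s N) <= e / 2 by exact/ltW/(NP N (leqnn N)).
by move: (bx _ _ h2); lra.
Qed.

Section along_a_path.
Variables (T : topologicalType).

(** Solutions are chosen pointwise. Continuity comes from c t - c s = g s (c t - c s) + (g t - g s)
    c t: as [g s] has norm at most 1/2, the first term is absorbed on the left, at the cost of a
    factor 2. *)
Lemma neumann_inverse_continuous (g : T -> A) :
  continuous g -> (forall t, cnorm (g t) <= 2^-1) ->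
  exists2 c : T -> A, continuous c & forall t, c t = 1 + g t * c t.
Proof.
move=> cg g2; have /choice[c cE] t := neumann_inverse (g2 t).
exists c => // t; apply/cnorm_cvgP => e e0.
pose K := cnorm (c t) + 1; have K0 : 0 < K by rewrite ltr_wpDl ?cnorm_ge0.
have eK : 0 < e / (2 * K) by rewrite divr_gt0 // mulr_gt0.
have := (cnorm_cvgP g t).1 (cg t) _ eK; apply: filterS => s gts.
have E : c t - c s = g s * (c t - c s) + (g t - g s) * c t.
  rewrite {1}(cE t) {1}(cE s) opprD addrACA subrr add0r mulrBr mulrBl.
  by rewrite [RHS]addrC addrA subrK.
have : cnorm (c t - c s) <= 2^-1 * cnorm (c t - c s) + e / (2 * K) * cnorm (c t).
  rewrite {1}E; apply: le_trans (cnormD_le _ _) _.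
  apply: lerD; apply: le_trans (cnormM_le _ _) _; apply: ler_wpM2r;
    rewrite ?cnorm_ge0 //; exact: ltW.
have : e / (2 * K) * cnorm (c t) < e / 2.
  rewrite invfM mulrA -mulrA -[ltRHS]mulr1 ltr_pM2l ?divr_gt0 //.
  by rewrite mulrC ltr_pdivrMr // mul1r ltrDl.
lra.
Qed.
End along_a_path.

Section characters.
Variables (chi : A -> R[i]^o) (hchi : character chi).

(** Otherwise b = a / chi(a) has norm at most 1/2 and chi(b) = 1, and [chi] contradicts the equation
    of [neumann_inverse]. The constant 2 is the inverse of the radius there. *)
Lemma character_bound a : Normc.normc (chi a) <= 2 * cnorm a.
Proof.
rewrite leNgt; apply/negP => h.
have z0 : chi a != 0.
  apply: contraTneq h => ->; rewrite Normc.normc0 -leNgt mulr_ge0 ?cnorm_ge0 //.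
have [|c cE] := @neumann_inverse ((chi a)^-1 *: a).
  rewrite cnormZ Normc.normcV ler_pdivrMl; first by move: h; lra.
  by rewrite (le_lt_trans _ h) // mulr_ge0 ?cnorm_ge0.
have /eqP := congr1 chi cE.
rewrite (starhomD hchi) (starhom1 hchi) (starhomM hchi) (starhomZ hchi).
by rewrite /= [_ *: _]mulVf // mul1r -subr_eq subrr eq_sym oner_eq0.
Qed.

Lemma character_continuous (T : topologicalType) (f : T -> A) :
  continuous f -> continuous (chi \o f).
Proof.
move=> cf t; apply/cvg_normcP => e e0.
have e20 : 0 < e / 2 by rewrite divr_gt0.
have := (cnorm_cvgP f t).1 (cf t) _ e20; apply: filterS => s fts /=.
rewrite -(starhomB hchi); apply: le_lt_trans (character_bound _) _.
by rewrite mulrC -ltr_pdivlMr.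
Qed.

End characters.
End neumann.

(** * Characters of the equivariant join *)

Lemma unital_star_hom_comp (R : realType) (A B D : starAlgType R)
    (g : B -> D) (f : A -> B) :
  unital_star_hom g -> unital_star_hom f -> unital_star_hom (g \o f).
Proof.
move=> hg hf; split=> [c x y||x y|x] /=.
- by rewrite (starhom_linear hf) (starhom_linear hg).
- by rewrite (starhom1 hf) (starhom1 hg).
- by rewrite (starhomM hf) (starhomM hg).
- by rewrite (starhomS hf) (starhomS hg).
Qed.

(** [rho] is [phi] composed with an arbitrary section of [ev]; the condition on the kernel makes the
    result independent of the section, hence multiplicative and linear. *)
Lemma character_factor (R : realType) (E B : starAlgType R) (ev : E -> B)
    (phi : E -> R[i]^o) :
  unital_star_hom ev -> (forall b, exists x, ev x = b) -> character phi ->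
  (forall x, ev x = 0 -> phi x = 0) ->
  exists2 rho : B -> R[i]^o, character rho & phi = rho \o ev.
Proof.
move=> hev /choice[s sK] hphi ker.
have phiE x : phi (s (ev x)) = phi x.
  apply/eqP; rewrite -subr_eq0 -(starhomB hphi); apply/eqP/ker.
  by rewrite (starhomB hev) sK subrr.
exists (phi \o s); last by apply/funext => x; rewrite /= phiE.
split=> [c x y||x y|x] /=.
- by rewrite -(starhom_linear hphi) -[RHS]phiE (starhom_linear hev) !sK.
- by rewrite -(starhom1 hphi) -[RHS]phiE (starhom1 hev).
- by rewrite -(starhomM hphi) -[RHS]phiE (starhomM hev) !sK.
- by rewrite -(starhomS hphi) -[RHS]phiE (starhomS hev) !sK.
Qed.

Lemma starsub0 (R : realType) (B : starAlgType R) (S : starSubalgebra B) :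
  starsub_set S 0.
Proof. by rewrite -(scale0r (1 : B)); apply/starsubZ/starsub1. Qed.

Lemma continuous_maxr (R : realType) (T : topologicalType) (f g : T -> R) :
  continuous f -> continuous g -> continuous (fun t => Num.max (f t) (g t)).
Proof.
move=> cf cg t; under eq_fun do rewrite maxr_absE.
apply: cvgMr_tmp.
exact: (cvgD (cvgD (cf t) (cg t)) (cvg_norm (cvgB (cf t) (cg t)))).
Qed.

Section interval.
Variable R : realType.
Notation I := (I01 R).

Definition ipt (t : I) : R := \val t.

Lemma ipt_continuous : continuous ipt.
Proof. exact: initial_continuous. Qed.

Lemma ipt_ge0 t : 0 <= ipt t.
Proof. by have := set_mem (valP t); rewrite /= in_itv => /andP[]. Qed.

Lemma ipt_le1 t : ipt t <= 1.
Proof. by have := set_mem (valP t); rewrite /= in_itv => /andP[]. Qed.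

Lemma ipt_onto (r : R) : 0 <= r <= 1 -> exists t, ipt t = r.
Proof.
move=> r01; have h : r \in `[0%R, 1%R]%classic by rewrite inE /= in_itv.
by exists (exist _ r h).
Qed.

Lemma nbhs_ipt (t : I) (U : set I) : nbhs t U ->
  exists2 e : R, 0 < e & forall s, `|ipt s - ipt t| < e -> U s.
Proof.
case=> _ [[W oW <-] Wt WU].
have /nbhs_ballP[e e0 eW] : nbhs (ipt t) W by exact: open_nbhs_nbhs.
by exists e => // s st; apply: WU; apply: eW; rewrite /ball /= distrC.
Qed.

Lemma continuous_to_I (T : topologicalType) (f : T -> I) :
  continuous (ipt \o f) -> continuous f.
Proof. by move=> cf; apply: continuous_comp_initial. Qed.

End interval.

Section join_characters.
Variables (R : realType) (A : cstarAlgType R) (G : compactQuantumGroup R).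
Variable delta : coaction A G.
Notation AH := (coact_AH delta).
Notation E := (join delta).
Notation I := (I01 R).
Implicit Types (f g : E) (q k : I -> R) (x : AH) (t : I) (e : R).

Lemma join_continuous f : continuous (\val f).
Proof. by have [] := set_mem (valP f). Qed.

Lemma join_ext f g : (forall t, \val f t = \val g t) -> f = g.
Proof. by move=> fg; apply/val_inj/funext. Qed.

Lemma join_exists (h : I -> AH) : continuous h ->
  starsub_set (deltaA delta) (h I0) -> starsub_set (C_tensor_H delta) (h I1) ->
  exists f, \val f = h.
Proof.
move=> ch h0 h1; have hE : join_set h by [].
by exists (exist _ h (mem_set hE)).
Qed.

Lemma scaled_continuous q (h : I -> AH) :
  continuous q -> continuous h -> continuous (fun t => (q t)%:C *: h t).
Proof.
move=> cq ch.
have cq1 : continuous (fun t => (q t)%:C *: (1 : AH)).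
  move=> t; apply/cnorm_cvgP => e e0.
  pose K := cnorm (1 : AH) + 1.
  have K0 : 0 < K by rewrite ltr_wpDl ?cnorm_ge0.
  have eK : 0 < e / K by rewrite divr_gt0.
  have /cvgrPdist_lt/(_ _ eK) := cq t; apply: filterS => s qts.
  rewrite -scalerBl cnormZ -rmorphB normc_real.
  apply: le_lt_trans (_ : `|q t - q s| * K < e); last by rewrite -ltr_pdivlMr.
  by rewrite ler_wpM2l // lerDl.
under eq_fun do rewrite -[X in _ *: X]mul1r scalerAl.
exact: cstar_continuousM.
Qed.

Lemma join_valM f g t : \val (f * g) t = \val f t * \val g t.
Proof. by rewrite rmorphM. Qed.

Lemma join_valD f g t : \val (f + g) t = \val f t + \val g t.
Proof. by rewrite raddfD. Qed.

Lemma join_valB f g t : \val (f - g) t = \val f t - \val g t.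
Proof. by rewrite raddfB. Qed.

Lemma join_valZ (c : R[i]) f t : \val (c *: f) t = c *: \val f t.
Proof. by rewrite linearZ. Qed.

Lemma join_val1 t : \val (1 : E) t = 1.
Proof. by rewrite rmorph1. Qed.

Lemma join_val_star f t : \val (star f) t = star (\val f t).
Proof. by rewrite -[LHS]/(star (\val f) t). Qed.

(** A central element: its values are scalars, which lie in both endpoint subalgebras. For
    discontinuous [q], [insubd] returns the default 1, whence the hypothesis of [scalE]. *)
Definition scal q : E := insubd (1 : E) (fun t => (q t)%:C *: (1 : AH)).

Lemma scalE q t : continuous q -> \val (scal q) t = (q t)%:C *: 1.
Proof.
move=> cq; rewrite /scal insubdK // inE; split.
- by apply: scaled_continuous => //; exact: cst_continuous.
- exact/starsubZ/starsub1.
- exact/starsubZ/starsub1.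
Qed.

Lemma scalM q f t : continuous q -> \val (scal q * f) t = (q t)%:C *: \val f t.
Proof.
move=> cq; by rewrite join_valM scalE // -scalerAl mul1r.
Qed.

Variables (phi : E -> R[i]^o) (hphi : character phi).

Let phi1 : phi 1 = 1. Proof. exact: starhom1 hphi. Qed.

Lemma phi_ipt_real : exists r : R, phi (scal (@ipt R)) = r%:C.
Proof.
have cI := @ipt_continuous R.
have : star (scal (@ipt R)) = scal (@ipt R).
  apply: join_ext => t.
  rewrite join_val_star scalE // starZ star1.
  by rewrite -[Num.conj _]/(conjc _) conjc_real.
move/(congr1 phi); rewrite (starhomS hphi) => h.
exists (complex.Re (phi (scal (@ipt R)))).
case: (phi _) h => a b [/eqP].
rewrite -subr_eq0 -opprD oppr_eq0 -mulr2n mulrn_eq0 /= => /eqP -> //.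
Qed.

(** If the value r were outside [0, 1], then t - r would be invertible in the join, although [phi]
    sends it to 0. *)
Lemma phi_coordinate : exists t0, phi (scal (@ipt R)) = (ipt t0)%:C.
Proof.
have [r hr] := phi_ipt_real; have cI := @ipt_continuous R.
suff /ipt_onto[t tr] : 0 <= r <= 1 by exists t; rewrite tr.
apply: contrapT => r01.
have rt t : ipt t - r != 0.
  apply/negP => /eqP/subr0_eq h; apply: r01.
  by rewrite -h ipt_ge0 ipt_le1.
have cq : continuous (fun t => (ipt t - r)^-1).
  have cB : continuous (fun t => ipt t - r).
    by move=> t; exact: (cvgB (cI t) (cvg_cst r)).
  by move=> t; exact: (cvgV (rt t) (cB t)).
have /(congr1 phi) : scal (fun t => (ipt t - r)^-1) *
    (scal (@ipt R) - r%:C *: 1) = 1.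
  apply: join_ext => t; rewrite scalM //.
  rewrite join_valB join_valZ !join_val1 scalE //.
  by rewrite -scalerBl scalerA -rmorphB -rmorphM mulVf // rmorph1 scale1r.
rewrite (starhomM hphi) (starhomB hphi) (starhomZ hphi) hr phi1.
rewrite -[r%:C *: 1]/(r%:C * 1) mulr1 subrr mulr0 => /eqP.
by rewrite eq_sym oner_eq0.
Qed.

Variables (t0 : I) (ht0 : phi (scal (@ipt R)) = (ipt t0)%:C).

(* [1 - k] is divisible by [(t - t0)^2], on which [phi] vanishes. *)
Lemma cutoff e : 0 < e -> exists k,
  [/\ continuous k, (forall t, 0 <= k t <= 1), k t0 = 1,
      (forall t, e <= `|ipt t - ipt t0| -> k t = 0) & phi (scal k) = 1].
Proof.
move=> e0; have cI := @ipt_continuous R.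
(* The cutoff is 1 - d/m. The maximum keeps [m] positive, so that 1/m is continuous, and makes m = d
   at distance at least [e] from [t0], where the cutoff then vanishes. *)
pose d t := (ipt t - ipt t0) ^+ 2; pose m t := Num.max (e ^+ 2) (d t).
have d0 t : 0 <= d t by exact: sqr_ge0.
have m0 t : 0 < m t by rewrite lt_max exprn_gt0.
have dm t : d t <= m t by rewrite le_max lexx orbT.
have cd : continuous d.
  move=> t; rewrite /d; under eq_fun do rewrite expr2.
  have h : (fun s => ipt s - ipt t0) @ t --> ipt t - ipt t0.
    exact: (cvgB (cI t) (cvg_cst _)).
  exact: (cvgM h h).
have cm0 : continuous m.
  exact: continuous_maxr (@cst_continuous _ _ _) cd.
have cm : continuous (fun t => (m t)^-1).
  by move=> t; exact: (cvgV (lt0r_neq0 (m0 t)) (cm0 t)).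
have ck : continuous (fun t => 1 - (m t)^-1 * d t).
  by move=> t; exact: (cvgB (cvg_cst _) (cvgM (cm t) (cd t))).
exists (fun t => 1 - (m t)^-1 * d t); split=> //.
- move=> t; rewrite mulrC subr_ge0 ler_pdivrMr // mul1r dm /=.
  by rewrite lerBlDr lerDl divr_ge0 // ltW.
- by rewrite /d subrr expr0n mulr0 subr0.
- move=> t et; have -> : m t = d t.
    rewrite /m max_r // /d -[leRHS]real_normK ?num_real //.
    by rewrite ler_pXn2r ?nnegrE // ltW.
  rewrite mulVf ?subrr // sqrf_eq0 -normr_gt0; exact: lt_le_trans et.
pose u := scal (@ipt R) - (ipt t0)%:C *: 1.
have -> : scal (fun t => 1 - (m t)^-1 * d t) =
    1 - scal (fun t => (m t)^-1) * (u * u).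
  apply: join_ext => t; rewrite scalE // join_valB scalM // join_valM.
  rewrite join_valB join_valZ !join_val1 scalE // -scalerBl -rmorphB.
  rewrite -scalerAl mul1r !scalerA -!rmorphM rmorphB rmorph1 scalerBl scale1r.
  by rewrite /d expr2 mulrA.
rewrite (starhomB hphi) !(starhomM hphi) (starhomB hphi) (starhomZ hphi).
rewrite ht0 phi1.
by rewrite -[_ *: 1]/(_ * 1) mulr1 subrr !mulr0 subr0.
Qed.

Lemma join_character_local f : \val f t0 = 0 -> phi f = 0.
Proof.
move=> ft0; apply: contrapT => /eqP phif.
wlog phif1 : f ft0 phif / phi f = 1.
  move=> /(_ ((phi f)^-1 *: f)); apply.
  - by rewrite join_valZ ft0 scaler0.
  - by rewrite (starhomZ hphi) -[_ *: _]/(_ * _) mulVf // oner_eq0.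
  - by rewrite (starhomZ hphi) -[_ *: _]/(_ * _) mulVf.
have [e e0 fe] : exists2 e : R, 0 < e &
    forall t, `|ipt t - ipt t0| < e -> cnorm (\val f t) <= 2^-1.
  have h2 : 0 < 2^-1 :> R by rewrite invr_gt0.
  have [e e0 fe] := nbhs_ipt ((cnorm_cvgP _ t0).1 (@join_continuous f t0) _ h2).
  exists e => // t /fe; rewrite ft0 sub0r cnormN; exact: ltW.
(* [e1] is at most the distance from [t0] to each endpoint other than [t0]. So at an endpoint either
   the cutoff vanishes, or the endpoint is [t0] and [f] vanishes. *)
have [e1 [e10 e1e e1P0 e1P1]] : exists e1, [/\ 0 < e1, e1 <= e,
    ipt t0 != 0 -> e1 <= ipt t0 & ipt t0 != 1 -> e1 <= 1 - ipt t0].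
  exists (Num.min e (Num.min (if ipt t0 == 0 then e else ipt t0)
                             (if ipt t0 == 1 then e else 1 - ipt t0))).
  split; [|by rewrite ge_min lexx|
           by move=> /negbTE ->; rewrite !ge_min lexx !orbT..].
  rewrite !lt_min e0 /=; apply/andP; split; case: ifPn => // h.
    by rewrite lt_def h ipt_ge0.
  by rewrite subr_gt0 lt_def eq_sym h ipt_le1.
have [k [ck k01 kt0 ke phik]] := cutoff e10.
pose g := scal k * f.
have phig : phi g = 1 by rewrite (starhomM hphi) phik phif1 mulr1.
have gE t : \val g t = (k t)%:C *: \val f t by exact: scalM.
have k_norm t : cnorm (\val g t) <= 2^-1.
  rewrite gE cnormZ normc_real; case: (ltP `|ipt t - ipt t0| e1) => h.
    have /andP[k0 k1] := k01 t; rewrite ger0_norm // -[leRHS]mul1r.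
    by apply: ler_pM; rewrite ?cnorm_ge0 // fe // (lt_le_trans h).
  by rewrite ke // normr0 mul0r invr_ge0.
have g_end t : (ipt t != ipt t0 -> e1 <= `|ipt t - ipt t0|) -> \val g t = 0.
  move=> h; rewrite gE; have [tt0|/h/ke ->] := eqVneq (ipt t) (ipt t0).
    by rewrite (_ : t = t0) ?ft0 ?scaler0 //; exact: val_inj.
  by rewrite scale0r.
have g0 : \val g I0 = 0.
  apply: g_end; rewrite eq_sym => /e1P0.
  by rewrite sub0r normrN ger0_norm ?ipt_ge0.
have g1 : \val g I1 = 0.
  apply: g_end; rewrite eq_sym => /e1P1.
  by rewrite ger0_norm ?subr_ge0 ?ipt_le1.
(* As [g] is 0 at both endpoints, the solution [c] is 1 there and therefore belongs to the join. *)
have [c cc cE] := neumann_inverse_continuous (@join_continuous g) k_norm.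
have [||f' f'E] := join_exists cc.
- by rewrite cE g0 mul0r addr0; exact: starsub1.
- by rewrite cE g1 mul0r addr0; exact: starsub1.
have /(congr1 phi) : f' = 1 + g * f'.
  apply: join_ext => t; rewrite join_valD join_valM join_val1 f'E; exact: cE.
rewrite (starhomD hphi) (starhomM hphi) phig phi1 mul1r => /eqP.
by rewrite -subr_eq subrr eq_sym oner_eq0.
Qed.

End join_characters.

Lemma ptws_continuous (T : topologicalType) (U : Type) (V : topologicalType)
    (g : T -> {ptws U -> V}) :
  (forall u, continuous (fun t => g t u)) -> continuous g.
Proof.
move=> cg t; apply/cvg_sup => u W; case=> _ [[Q oQ <-] Qtu QW].
have Qu : nbhs (g t u) Q by exact: open_nbhs_nbhs.
have H : nbhs t (fun s => Q (g s u)) by exact: cg Qu.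
suff : nbhs t (fun s => W (g s)) by [].
by apply: filterS H => s; exact: QW.
Qed.

(** * Fibres of the join and paths between evaluations *)

Section join_paths.
Variables (R : realType) (A : cstarAlgType R) (G : compactQuantumGroup R).
Variable delta : coaction A G.
Notation AH := (coact_AH delta).
Notation E := (join delta).
Notation I := (I01 R).

Definition ev_at (t : I) (f : E) : AH := \val f t.

Lemma ev_at_hom t : unital_star_hom (ev_at t).
Proof.
rewrite /ev_at; split=> [c f g||f g|f].
- by rewrite join_valD join_valZ.
- exact: join_val1.
- exact: join_valM.
- exact: join_val_star.
Qed.

Lemma ev0_hom : unital_star_hom (@ev0 R A G delta).
Proof.
have h := ev_at_hom I0.
split=> [c f g||f g|f]; apply: val_inj.
- by rewrite linearP; exact: (starhom_linear h).
- by rewrite rmorph1; exact: (starhom1 h).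
- by rewrite rmorphM; exact: (starhomM h).
- exact: (starhomS h).
Qed.

Lemma ev1_hom : unital_star_hom (@ev1 R A G delta).
Proof.
have h := ev_at_hom I1.
split=> [c f g||f g|f]; apply: val_inj.
- by rewrite linearP; exact: (starhom_linear h).
- by rewrite rmorph1; exact: (starhom1 h).
- by rewrite rmorphM; exact: (starhomM h).
- exact: (starhomS h).
Qed.

Lemma starsub_val_hom (B : starAlgType R) (S : starSubalgebra B) :
  unital_star_hom (\val : S -> B).
Proof.
split=> [c x y||x y|x].
- by rewrite linearP.
- by rewrite rmorph1.
- by rewrite rmorphM.
- by [].
Qed.

(** The lift t |-> (1 - t) x is 0 at the other endpoint, so it satisfies the boundary condition
    there; [ev1_surj] uses t |-> t x. *)
Lemma ev0_surj x : exists f, @ev0 R A G delta f = x.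
Proof.
have cq : continuous (fun t : I => 1 - ipt t).
  by move=> t; exact: (cvgB (@cst_continuous I R 1 t) (@ipt_continuous R t)).
have [||f fE] := join_exists
  (scaled_continuous (delta := delta) cq (@cst_continuous _ _ (\val x))).
- rewrite /ipt /= subr0 rmorph1 scale1r; exact: (set_mem (valP x)).
- rewrite /ipt /= subrr rmorph0 scale0r; exact: (starsub0 (C_tensor_H delta)).
exists f; apply: val_inj.
by rewrite -[LHS]/(\val f I0) fE /ipt /= subr0 rmorph1 scale1r.
Qed.

Lemma ev1_surj x : exists f, @ev1 R A G delta f = x.
Proof.
have [||f fE] := join_exists
  (scaled_continuous (delta := delta) (@ipt_continuous R)
    (@cst_continuous _ _ (\val x))).
- rewrite /ipt /= rmorph0 scale0r; exact: (starsub0 (deltaA delta)).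
- rewrite /ipt /= rmorph1 scale1r; exact: (set_mem (valP x)).
exists f; apply: val_inj.
by rewrite -[LHS]/(\val f I1) fE /ipt /= rmorph1 scale1r.
Qed.

Lemma ev_at_surj t x : 0 < ipt t < 1 -> exists f, ev_at t f = x.
Proof.
move=> /andP[t0 t1].
(* [q] vanishes at both endpoints but not at [t]; the lift of [x] is q(s)/q(t) times [x]. *)
pose q (s : I) := (1 - ipt s) * ipt s.
have cq : continuous q.
  move=> s; have cI := @ipt_continuous R s.
  exact: (cvgM (cvgB (@cst_continuous I R 1 s) cI) cI).
have qt0 : q t != 0 by rewrite mulf_neq0 // ?subr_eq0 ?gt_eqF.
have [||f fE] := join_exists
  (scaled_continuous (delta := delta) cq
    (@cst_continuous _ _ ((q t)%:C^-1 *: x))).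
- rewrite /q /ipt /= mulr0 rmorph0 scale0r; exact: (starsub0 (deltaA delta)).
- rewrite /q /ipt /= subrr mul0r rmorph0 scale0r.
  exact: (starsub0 (C_tensor_H delta)).
exists f; rewrite /ev_at fE scalerA mulfV ?scale1r //.
by rewrite -(rmorph0 (real_complex R)) (inj_eq (@complexI R)).
Qed.

Lemma join_character_fiber (phi : E -> R[i]^o) : character phi ->
  [\/ exists2 rho : deltaA delta -> R[i]^o, character rho &
        phi = rho \o @ev0 R A G delta,
      exists2 rho : C_tensor_H delta -> R[i]^o, character rho &
        phi = rho \o @ev1 R A G delta |
      exists t, exists2 rho : AH -> R[i]^o, character rho &
        phi = rho \o ev_at t].
Proof.
move=> hphi; have [t ht] := phi_coordinate hphi.
have local := join_character_local hphi ht.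
have [t0|t0] := eqVneq (ipt t) 0.
  have tI : t = I0 by exact: val_inj.
  apply: Or31; apply: character_factor => //; [exact: ev0_hom|exact: ev0_surj|].
  move=> f /(congr1 \val) f0; apply: local.
  by rewrite tI -[LHS]/(\val (ev0 f)) f0 rmorph0.
have [t1|t1] := eqVneq (ipt t) 1.
  have tI : t = I1 by exact: val_inj.
  apply: Or32; apply: character_factor => //; [exact: ev1_hom|exact: ev1_surj|].
  move=> f /(congr1 \val) f0; apply: local.
  by rewrite tI -[LHS]/(\val (ev1 f)) f0 rmorph0.
apply: Or33; exists t; apply: (character_factor (ev_at_hom t)) => //.
move=> x; apply: ev_at_surj.
by rewrite !lt_def t0 ipt_ge0 eq_sym t1 ipt_le1.
Qed.

(** The point of evaluation moves along the segment from [s] to [t]. Pointwise convergence only asks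
    that each rho(f(w r)) be continuous in r, which holds because characters are continuous. *)
Lemma ev_at_path (rho : AH -> R[i]^o) (s t : I) : character rho ->
  character_path (rho \o ev_at s) (rho \o ev_at t).
Proof.
move=> hrho.
have /choice[w wE] (r : I) :
    exists v, ipt v = (1 - ipt r) * ipt s + ipt r * ipt t.
  apply: ipt_onto; have := ipt_ge0 r; have := ipt_le1 r.
  have := ipt_ge0 s; have := ipt_le1 s; have := ipt_ge0 t; have := ipt_le1 t.
  by move=> *; apply/andP; split; nra.
have cw : continuous w.
  apply: continuous_to_I => r; rewrite [_ \o _](funext wE).
  have cI := @ipt_continuous R r.
  exact: (cvgD (cvgMr_tmp (cvgB (@cst_continuous I R 1 r) cI)) (cvgMr_tmp cI)).
exists (fun r => rho \o ev_at (w r)); split.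
- apply: ptws_continuous => f.
  apply: (character_continuous hrho (f := \val f \o w)) => r.
  exact: continuous_comp (cw r) (@join_continuous _ _ _ _ f (w r)).
- by move=> r; apply: unital_star_hom_comp => //; exact: ev_at_hom.
- congr (_ \o ev_at _); apply: val_inj.
  by rewrite -[LHS]/(ipt _) wE /ipt /= subr0 mul1r mul0r addr0.
- congr (_ \o ev_at _); apply: val_inj.
  by rewrite -[LHS]/(ipt _) wE /ipt /= subrr mul1r mul0r add0r.
Qed.

Lemma constant_path (phi : E -> R[i]^o) : character phi -> character_path phi phi.
Proof.
by move=> hphi; exists (fun=> phi); split=> //; exact: cst_continuous.
Qed.

End join_paths.

(** * Products of characters *)

Section scalar_hilbert_space.
Variable R : realType.
Notation C := R[i].

(* An alias: completeness of [K^o] is already keyed on [K : realType]. *)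
Definition scalars : Type := C^o.
HB.instance Definition _ := NormedModule.copy scalars C^o.
HB.instance Definition _ :=
  Uniform_isComplete.Build scalars (@complex_cauchy_cvg R).

Let scalar_inner (x y : scalars) : C := x * Num.conj y.
Let scalar_innerDl x y z :
  scalar_inner (x + y) z = scalar_inner x z + scalar_inner y z.
Proof. exact: mulrDl. Qed.
Let scalar_innerZl c x y : scalar_inner (c *: x) y = c * scalar_inner x y.
Proof. by rewrite /scalar_inner mulrA. Qed.
Let scalar_innerC x y : scalar_inner y x = Num.conj (scalar_inner x y).
Proof. 
by rewrite /scalar_inner rmorphM [LHS]mulrC; congr (_ * _); exact/esym/conjCK.
 Qed.
Let scalar_inner_norm (x : scalars) : scalar_inner x x = `|x| ^+ 2.
Proof. by rewrite normCK. Qed.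

HB.instance Definition _ := isHilbert.Build R scalars
  scalar_innerDl scalar_innerZl scalar_innerC scalar_inner_norm.

Lemma scalar_innerE (x y : scalars) : inner x y = x * Num.conj y.
Proof. by []. Qed.

End scalar_hilbert_space.

(** A character is a one-dimensional representation, so the spatial norm can be tested on pairs of
    characters. *)
Lemma character_representation (R : realType) (A : starAlgType R)
    (chi : A -> R[i]^o) :
  character chi ->
  representation (K := scalars R) (fun a z => chi a * z).
Proof.
move=> hchi; split.
- by move=> a c x y; rewrite mulrDr -scalerAr.
- move=> a; exact: mulrl_continuous.
- by move=> a b x; rewrite (starhomD hchi) mulrDl.
- by move=> c a x; rewrite (starhomZ hchi) -scalerAl.
- by move=> x; rewrite (starhom1 hchi) mul1r.
- by move=> a b x; rewrite (starhomM hchi) mulrA.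
- move=> a x y; rewrite !scalar_innerE (starhomS hchi).
  suff E (c u v : R[i]) : c * u * Num.conj v = u * Num.conj (Num.conj c * v).
    exact: E.
  by rewrite rmorphM /= conjCK mulrCA mulrA.
Qed.

Section algebraic_tensor.
Variables (R : realType) (A B : cstarAlgType R) (AB : minTensor A B).
Notation C := R[i].
Implicit Types (x y : seq (A * B)) (u v w : AB).

Definition tsum x : AB := \sum_(p <- x) tensor AB p.1 p.2.

Lemma tensorDl a a' b : tensor AB (a + a') b = tensor AB a b + tensor AB a' b.
Proof. by have := tensor_linearl AB b 1 a a'; rewrite !scale1r. Qed.
Lemma tensor0l b : tensor AB 0 b = 0.
Proof. by apply: (addrI (tensor AB 0 b)); rewrite -tensorDl !addr0. Qed.
Lemma tensorZl (c : C) a b : tensor AB (c *: a) b = c *: tensor AB a b.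
Proof. by have := tensor_linearl AB b c a 0; rewrite tensor0l !addr0. Qed.

Lemma tsum_cat x y : tsum (x ++ y) = tsum x + tsum y.
Proof. by rewrite /tsum big_cat. Qed.

(** Lists of pairs serve as formal sums of elementary tensors; [tsum], and later [tval], carry these
    list operations to the algebra operations. *)
Definition tscale (c : C) x : seq (A * B) := [seq (c *: p.1, p.2) | p <- x].
Definition tmul x y : seq (A * B) :=
  [seq (p.1 * q.1, p.2 * q.2) | p <- x, q <- y].
Definition tstar x : seq (A * B) := [seq (star p.1, star p.2) | p <- x].

Lemma tsumZ c x : tsum (tscale c x) = c *: tsum x.
Proof.
by rewrite /tsum big_map scaler_sumr; apply: eq_bigr => p _; rewrite tensorZl.
Qed.

Lemma tsumM x y : tsum (tmul x y) = tsum x * tsum y.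
Proof.
rewrite /tsum big_allpairs_dep big_distrlr /=.
by apply: eq_bigr => p _; apply: eq_bigr => q _; rewrite tensorM.
Qed.

Lemma star_sum (D : starAlgType R) (I : Type) (s : seq I) (F : I -> D) :
  star (\sum_(i <- s) F i) = \sum_(i <- s) star (F i).
Proof.
elim: s => [|i s ih]; last by rewrite !big_cons starD ih.
by rewrite !big_nil; apply: (addrI (star 0)); rewrite -starD !addr0.
Qed.

Lemma tsum_star x : tsum (tstar x) = star (tsum x).
Proof.
by rewrite /tsum big_map star_sum; apply: eq_bigr => p _; rewrite tensorS.
Qed.

(** The coefficients in a span can be absorbed into the first tensor factor, so sums without
    coefficients are already dense. *)
Lemma tsum_dense w e : 0 < e -> exists x, cnorm (w - tsum x) < e.
Proof.
move=> e0; have : closure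
    (Defs.span [set tensor AB a b | a in setT & b in setT]) w.
  by rewrite tensor_dense.
have : nbhs w (ball_ (@cnorm R AB) w e) by apply/nbhs_cnormP; exists e.
move=> nw /(_ _ nw)[v [[s sP ->] we]].
suff [x xE] : exists x, \sum_(p <- s) p.1 *: p.2 = tsum x by exists x; rewrite -xE.
elim: s sP {we} => [|p s ih] sP; first by exists [::]; rewrite /tsum !big_nil.
have [q qs|x xE] := ih; first by apply: sP; rewrite inE qs orbT.
have [a _ [b _ ab]] := sP p (mem_head _ _).
exists ((p.1 *: a, b) :: x).
by rewrite /tsum !big_cons xE -ab tensorZl.
Qed.

End algebraic_tensor.

Section density.
Variable R : realType.

Lemma closed_coincidence (T : topologicalType) (f g : T -> R[i]^o) :
  continuous f -> continuous g -> closed [set t | f t = g t].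
Proof.
move=> cf cg t clt /=; apply/eqP; rewrite -subr_eq0.
apply/eqP/Normc.eq0_normc/eqP; rewrite eq_le normc_ge0 andbT.
apply/ler_addgt0Pl => e e0; rewrite addr0.
have e20 : 0 < e / 2 by rewrite divr_gt0.
have nf := (continuous_normcP f t).1 (cf t) _ e20.
have ng := (continuous_normcP g t).1 (cg t) _ e20.
have [v [/= fgv [fv gv]]] := clt _ (filterI nf ng).
have -> : f t - g t = (f t - f v) - (g t - g v).
  by rewrite fgv opprB addrA subrK.
rewrite (splitr e); apply: le_trans (normc_triangle _ _) _.
by rewrite normcN; apply/ltW/ltrD.
Qed.

Lemma continuous_dense_eq (T : topologicalType) (D : set T) (f g : T -> R[i]^o) :
  closure D = setT -> continuous f -> continuous g -> {in D, f =1 g} -> f = g.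
Proof.
move=> clD cf cg fg; apply/funext => w.
apply: (closed_coincidence cf cg); suff : closure D w.
  by apply: closureS => t Dt; apply/fg/mem_set.
by rewrite clD.
Qed.

Lemma character_continuousT (B : cstarAlgType R) (f : B -> R[i]^o) :
  character f -> continuous f.
Proof.
by move=> hf; apply: (character_continuous hf (f := @id B)) => t; exact: cvg_id.
Qed.

(** Characters are continuous and linear, so agreement on [D] passes to its closed span. The set [D]
    may be any spanning family, such as the products in the density condition of a coaction. *)
Lemma character_span_eq (B : cstarAlgType R) (D : set B) (f g : B -> R[i]^o) :
  closure (Defs.span D) = setT -> character f -> character g ->
  {in D, f =1 g} -> f = g.
Proof.
move=> clD hf hg fg; apply: (continuous_dense_eq clD).
- exact: character_continuousT.
- exact: character_continuousT.
move=> _ /set_mem[s sD ->]; elim: s sD => [|p s ih] sD.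
  by rewrite big_nil (starhom0 hf) (starhom0 hg).
rewrite big_cons (starhomD hf) (starhomD hg) (starhomZ hf) (starhomZ hg) fg ?ih //.
  by move=> q qs; apply: sD; rewrite inE qs orbT.
exact/mem_set/sD/mem_head.
Qed.

End density.

Lemma normc_star (R : realType) (z : R[i]^o) :
  Normc.normc (star z) = Normc.normc z.
Proof. by case: z => a b; rewrite -[star _]/(conjc _) /= sqrrN. Qed.

Lemma continuous_star (R : realType) (T : topologicalType) (f : T -> R[i]^o) :
  continuous f -> continuous (star \o f).
Proof.
move=> cf t; apply/continuous_normcP => e e0.
have := (continuous_normcP f t).1 (cf t) _ e0; apply: filterS => s.
rewrite -normc_star; congr (Normc.normc _ < e).
by rewrite starD -scaleN1r starZ rmorphN1 scaleN1r.
Qed.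

Section product_character.
Variables (R : realType) (A B : cstarAlgType R) (AB : minTensor A B).
Notation C := R[i].
Notation nc := (@Normc.normc R).
Notation tsum := (tsum AB).
Variables (chi : A -> C^o) (psi : B -> C^o).
Hypotheses (hchi : character chi) (hpsi : character psi).
Implicit Types (x y : seq (A * B)) (u v w : AB) (e : R).

(** The value that chi (x) psi must take at [tsum x]; that it depends on [tsum x] alone follows from
    [tval_dist]. *)
Definition tval x : C^o := \sum_(p <- x) chi p.1 * psi p.2.

Lemma tval_cat x y : tval (x ++ y) = tval x + tval y.
Proof. by rewrite /tval big_cat. Qed.

Lemma tvalZ c x : tval (tscale c x) = c *: tval x.
Proof.
rewrite /tval big_map scaler_sumr; apply: eq_bigr => p _ /=.
by rewrite (starhomZ hchi) scalerAl.
Qed.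

Lemma tvalM x y : tval (tmul x y) = tval x * tval y.
Proof.
rewrite /tval big_allpairs_dep big_distrlr /=.
apply: eq_bigr => p _; apply: eq_bigr => q _.
by rewrite (starhomM hchi) (starhomM hpsi) mulrACA.
Qed.

Lemma tval_star x : tval (tstar x) = star (tval x).
Proof.
rewrite /tval big_map star_sum; apply: eq_bigr => p _ /=.
by rewrite (starhomS hchi) (starhomS hpsi) starM mulrC.
Qed.

(** Test the spatial bound on the representations [chi] and [psi] and the unit vector 1 (x) 1: the
    image has squared norm |tval x|^2. *)
Lemma tval_le x : nc (tval x) <= cnorm (tsum x).
Proof.
have [M0] := tensor_norm_bound AB x.
move=> /(_ _ _ _ _ (character_representation hchi)
  (character_representation hpsi)).
move=> /(_ [:: (1 : C, 1 : C)]); rewrite -/(tsum x).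
have -> : tensor_act (fun a (z : scalars R) => chi a * z)
    (fun b (z : scalars R) => psi b * z) x [:: (1 : C, 1 : C)] =
    [seq (chi p.1 * 1, psi p.2 * 1) | p <- x].
  by rewrite /tensor_act; elim: x {M0} => //= p x ->.
have -> : tensor_sqnorm (K := scalars R) (L := scalars R) [:: (1, 1)] = 1.
  rewrite /tensor_sqnorm !big_seq1 !scalar_innerE.
  suff E : (1 : C) * Num.conj 1 * (1 * Num.conj 1) = 1 by exact: E.
  by rewrite rmorph1 !mulr1.
have -> : tensor_sqnorm (K := scalars R) (L := scalars R)
    [seq (chi p.1 * 1, psi p.2 * 1) | p <- x] = ((nc (tval x)) ^+ 2)%:C.
  rewrite rmorphXn /= -normrcE normCK /tensor_sqnorm big_map.
  rewrite [Num.conj _](rmorph_sum Num.conj) big_distrlr /=.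
  apply: eq_bigr => p _; rewrite big_map; apply: eq_bigr => q _ /=.
  rewrite !scalar_innerE.
  suff E (a b c d : C) : a * 1 * Num.conj (c * 1) * (b * 1 * Num.conj (d * 1)) =
      a * b * Num.conj (c * d) by exact: E.
  by rewrite !mulr1 rmorphM mulrACA.
by rewrite mulr1 lecR ler_pXn2r // nnegrE ?normc_ge0 ?cnorm_ge0.
Qed.

Lemma tval_dist x y : nc (tval x - tval y) <= cnorm (tsum x - tsum y).
Proof.
have -> : tval x - tval y = tval (x ++ tscale (-1) y).
  by rewrite tval_cat tvalZ scaleN1r.
have -> : tsum x - tsum y = tsum (x ++ tscale (-1) y).
  by rewrite tsum_cat tsumZ scaleN1r.
exact: tval_le.
Qed.

(** By [tval_dist], the values at sums close to [w] generate a Cauchy filter, and [z] is its limit.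
    The inequality for all [x] encodes both the agreement with [tval] on sums and the Lipschitz
    bound of the extension. *)
Lemma tval_extend w :
  exists z : C^o, forall x, nc (z - tval x) <= cnorm (w - tsum x).
Proof.
pose near_w e := [set x | cnorm (w - tsum x) < e].
pose F : set_system C^o := filter_from [set e | 0 < e] (fun e => tval @` near_w e).
have FF : ProperFilter F.
  apply: filter_from_proper => [|e e0]; last first.
    by have [x xe] := tsum_dense w e0; exists (tval x), x.
  apply: filter_from_filter; first by exists 1 => /=.
  move=> e d /= e0 d0; exists (Num.min e d); first by rewrite /= lt_min e0.
  move=> _ [x + <-]; rewrite /near_w /= lt_min => /andP[xe xd].
  by split; exists x.
have dist x y : cnorm (tsum x - tsum y) <= cnorm (w - tsum x) + cnorm (w - tsum y).
  rewrite -[cnorm (w - tsum x)]cnormN.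
  have -> : tsum x - tsum y = - (w - tsum x) + (w - tsum y).
    by rewrite opprB addrA subrK.
  exact: cnormD_le.
have cF : cauchy F.
  apply: cauchy_exP => e; rewrite ltcE/= => /andP[/eqP ei e0].
  have e20 : 0 < complex.Re e / 2 by rewrite divr_gt0.
  have [x xe] := tsum_dense w e20.
  exists (tval x), (complex.Re e / 2) => // _ [y ye <-].
  rewrite -ball_normE /= normrcE ltcE /= ei eqxx /=.
  apply: le_lt_trans (tval_dist _ _) _; apply: le_lt_trans (dist _ _) _.
  by rewrite [ltRHS](splitr (complex.Re e)); exact: ltrD.
have /cvg_ex[z Fz] := complex_cauchy_cvg FF cF.
exists z => x; apply/ler_addgt0Pr => e e0.
have e20 : 0 < e / 2 by rewrite divr_gt0.
have n1 : F [set v | nc (z - v) < e / 2].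
  exact: ((@cvg_normcP R C^o F id z _).1 Fz _ e20).
have n2 : F (tval @` near_w (e / 2)) by exists (e / 2).
have [v [/= zy [y ye yv]]] := filter_ex (filterI n1 n2); rewrite -yv in zy.
have := normc_triangle (z - tval y) (tval y - tval x); rewrite addrA subrK.
have := tval_dist y x; have := dist y x.
move: zy ye; rewrite /near_w /=; lra.
Qed.

Lemma product_character_exists : exists2 F : AB -> C^o, character F &
  forall a b, F (tensor AB a b) = chi a * psi b.
Proof.
have /choice[F FP] := tval_extend.
have FT x : F (tsum x) = tval x.
  apply/eqP; rewrite -subr_eq0; apply/eqP/Normc.eq0_normc/eqP.
  by rewrite eq_le normc_ge0 andbT (le_trans (FP _ x)) // subrr cnorm0.
have Flip u v : nc (F u - F v) <= cnorm (u - v).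
  apply/ler_addgt0Pr => e e0.
  have e20 : 0 < e / 2 by rewrite divr_gt0.
  have [x xe] := tsum_dense u e20.
  have := normc_triangle (F u - tval x) (tval x - F v); rewrite addrA subrK.
  rewrite -[nc (tval x - _)]normcN opprB.
  have := FP u x; have := FP v x.
  have := cnormD_le (v - u) (u - tsum x); rewrite addrA subrK (cnormB_sym v u).
  by move: xe; lra.
have cF (T : topologicalType) (f : T -> AB) : continuous f -> continuous (F \o f).
  move=> cf t; apply/continuous_normcP => e e0.
  have := (cnorm_cvgP f t).1 (cf t) _ e0; apply: filterS => s.
  exact: le_lt_trans (Flip _ _).
have clT : closure (range tsum) = setT.
  apply/seteqP; split=> // w _ U /nbhs_cnormP[e e0 eU].
  have [x xe] := tsum_dense w e0.
  by exists (tsum x); split; [exists x|exact: eU].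
(* Each algebraic identity holds on sums and extends by continuity; those in two variables are
   extended in one variable at a time. *)
have dense (f g : AB -> C^o) : continuous f -> continuous g ->
    (forall x, f (tsum x) = g (tsum x)) -> forall w, f w = g w.
  move=> cf cg fg w; rewrite (continuous_dense_eq clT cf cg) //.
  by move=> _ /set_mem[x _ <-].
have cid : continuous (@id AB) by move=> ?; exact: cvg_id.
have cc w : continuous (fun _ : AB => w) by exact: cst_continuous.
have FD u v : F (u + v) = F u + F v.
  apply: (dense (fun u => F (u + v)) (fun u => F u + F v)) => [||x].
  - by apply: cF; apply: cstar_continuousD.
  - by move=> w; exact: (cvgD (cF _ _ cid w) (@cst_continuous _ _ (F v) w)).
  apply: (dense (fun v => F (tsum x + v)) (fun v => F (tsum x) + F v)) => [||y].
  - by apply: cF; apply: cstar_continuousD.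
  - by move=> w; exact: (cvgD (@cst_continuous _ _ (F (tsum x)) w) (cF _ _ cid w)).
  by rewrite -tsum_cat !FT tval_cat.
have FZ c u : F (c *: u) = c *: F u.
  apply: (dense (fun u => F (c *: u)) (fun u => c *: F u)) => [||x].
  - by apply: cF; apply: cstar_continuousZ.
  - by move=> w; exact: (cvgZl_tmp (cF _ _ cid w)).
  by rewrite -tsumZ !FT tvalZ.
have FM u v : F (u * v) = F u * F v.
  apply: (dense (fun u => F (u * v)) (fun u => F u * F v)) => [||x].
  - by apply: cF; apply: cstar_continuousM.
  - by move=> w; exact: (cvgM (cF _ _ cid w) (@cst_continuous _ _ (F v) w)).
  apply: (dense (fun v => F (tsum x * v)) (fun v => F (tsum x) * F v)) => [||y].
  - by apply: cF; apply: cstar_continuousM.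
  - by move=> w; exact: (cvgM (@cst_continuous _ _ (F (tsum x)) w) (cF _ _ cid w)).
  by rewrite -tsumM !FT tvalM.
have tensorE a b : tensor AB a b = tsum [:: (a, b)] by rewrite /tsum big_seq1.
have Ftensor a b : F (tensor AB a b) = chi a * psi b.
  by rewrite tensorE FT /tval big_seq1.
exists F => //; split=> [c u v||u v|u].
- by rewrite FD FZ.
- by rewrite -(tensor1 AB) Ftensor (starhom1 hchi) (starhom1 hpsi) mulr1.
- exact: FM.
- apply: (dense (fun u => F (star u)) (fun u => star (F u))) => [||x].
  + by apply: cF; apply: cstar_continuous_star.
  + apply: continuous_star => //; exact: cF cid.
  by rewrite -tsum_star !FT tval_star.
Qed.

End product_character.

(** * The semigroup of characters of a compact quantum group *)

Section ellis.
Variables (T : topologicalType) (K : set T) (op : T -> T -> T).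
Hypotheses (hT : hausdorff_space T) (compactK : compact K) (K0 : K !=set0).
Hypothesis opK : forall x y, K x -> K y -> K (op x y).
Hypothesis opA : forall x y z, K x -> K y -> K z ->
  op (op x y) z = op x (op y z).
Hypothesis op_continuous : forall x, K x -> {within K, continuous (op x)}.

Let subsemigroup (S : set T) := [/\ S `<=` K, closed S, S !=set0 &
  forall x y, S x -> S y -> S (op x y)].

(** Zorn's lemma is applied to complements: a maximal [U] for which [K] minus [U] is a closed
    subsemigroup leaves a minimal one. *)
Let minimal_subsemigroup : exists2 S, subsemigroup S &
  forall S', S' `<=` S -> subsemigroup S' -> S `<=` S'.
Proof.
have closedK : closed K by exact: compact_closed.
pose P U := subsemigroup (K `\` U).
have P0 : P set0 by rewrite /P setD0; split.
have [|A [PA Amax]] := @Zorn_bigcup T P.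
  (* Adding [set0] to the chain gives a filter even for the empty chain. By compactness the filter
     of complements has a cluster point, which lies in all of them since they are closed; thus their
     intersection is not empty. *)
  move=> F FP Ftot; pose D U := U = set0 \/ F U.
  have DP U : D U -> P U by move=> [->|/FP].
  have Dtot U V : D U -> D V -> U `<=` V \/ V `<=` U.
    move=> [->|FU]; first by left.
    by move=> [->|FV]; [right|exact: Ftot].
  pose G := filter_from D (fun U => K `\` U).
  have GG : ProperFilter G.
    apply: filter_from_proper => [|U /DP[]//].
    apply: filter_from_filter; first by exists set0; left.
    move=> U V DU DV; have [UV|VU] := Dtot _ _ DU DV.
      by exists V => // x [Kx Vx]; split; split=> // /UV.
    by exists U => // x [Kx Ux]; split; split=> // /VU.
  have GK : G K by exists set0; [left|move=> x []].
  have [p [Kp clp]] := compactK GG GK.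
  have inD U x : D U -> closure (K `\` \bigcup_(X in F) X) x -> F U ->
      (K `\` U) x.
    move=> /DP[_ cl _ _] clx FU; apply: cl; apply: closureS clx => y [Ky nFy].
    by split=> // Uy; apply: nFy; exists U.
  split.
  - by move=> x [].
  - move=> x clx; split.
      by apply: closedK; apply: closureS clx => y [].
    by move=> [U FU Ux]; have [] := inD U x (or_intror FU) clx FU.
  - exists p; split=> // -[U FU Up].
    have [_ cl _ _] := FP _ FU.
    have [_ nUp] : (K `\` U) p.
      by apply: cl => V nV; apply: clp nV; exists U => //; right.
    exact: nUp.
  - move=> x y [Kx Ux] [Ky Uy]; split; first exact: opK.
    move=> [U FU]; have [_ _ _ sg] := FP _ FU.
    have [_ nU] : (K `\` U) (op x y).
      by apply: sg; split=> // h; [apply: Ux|apply: Uy]; exists U.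
    exact: nU.
exists (K `\` A) => // S' S'S S'P x [Kx Ax]; apply: contrapT => S'x.
apply: (Amax (A `|` (K `\` S'))).
  split; first by move=> y; left.
  by move=> /(_ x) h; apply: Ax; apply: h; right.
rewrite /P (_ : K `\` _ = S') //; apply/seteqP; split=> y.
  by move=> [Ky /not_orP[_ h]]; apply: contrapT => S'y; exact: h.
move=> S'y; have [Ky Ay] := S'S _ S'y.
by split=> // -[//|[]].
Qed.

(** Let x be in a minimal S. Then xS is a closed subsemigroup of S, so xS = S and xy = x for some y
    in S. The set of all such y is again a closed subsemigroup, hence S, and it contains x. Only
    translations y |-> xy have to be continuous. *)
Lemma ellis_idempotent : exists2 e, K e & op e e = e.
Proof.
have [S [SK clS [x Sx] Sop] Smin] := minimal_subsemigroup.
have cx := op_continuous (SK _ Sx).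
have compactS : compact S by exact: subclosed_compact compactK SK.
have [||y Sy xy] := Smin (op x @` S) _ _ x Sx.
- by move=> _ [y Sy <-]; exact: Sop.
- split.
  + by move=> _ [y Sy <-]; apply/SK/Sop.
  + apply: compact_closed => //; apply: continuous_compact compactS.
    exact: continuous_subspaceW SK cx.
  + by exists (op x x), x.
  + move=> _ _ [y Sy <-] [z Sz <-]; exists (op y (op x z)).
      exact: (Sop _ _ Sy (Sop _ _ Sx Sz)).
    by rewrite opA //; apply: (SK) => //; exact: Sop.
have [||_ xx] := Smin [set y | S y /\ op x y = x] _ _ x Sx.
- by move=> z [].
- split.
  + by move=> z [/SK].
  + have : closed (op x @^-1` [set x] : set (subspace K)).
      apply: closed_comp; first by move=> z _; exact: cx.
      by apply: accessible_closed_set1; exact: hausdorff_accessible.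
    move=> /closed_subspaceP[V clV VK].
    rewrite (_ : [set _ | _] = S `&` V); first exact: closedI.
    apply/seteqP; split=> z [Sz h]; split=> //.
      have : ((op x @^-1` [set x]) `&` K) z by split=> //; exact: SK.
      by rewrite -VK => -[].
    have : (V `&` K) z by split=> //; exact: SK.
    by rewrite VK => -[].
  + by exists y.
  + move=> a b [Sa xa] [Sb xb]; split; first exact: Sop.
    by rewrite -opA ?xa //; exact: SK.
by exists x => //; exact: SK.
Qed.

End ellis.

Lemma continuous_sum_seq (R : realType) (T : topologicalType) (J : Type)
    (s : seq J) (F : J -> T -> R[i]^o) :
  (forall j, continuous (F j)) -> continuous (fun t => \sum_(j <- s) F j t).
Proof.
move=> cF; elim: s => [|j s ih].
  by under eq_fun do rewrite big_nil; exact: cst_continuous.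
under eq_fun do rewrite big_cons.
by move=> t; exact: (cvgD (cF j t) (ih t)).
Qed.

(** * Convolution of characters along a coaction *)

Section product.
Variables (R : realType) (A B : cstarAlgType R) (AB : minTensor A B).
Implicit Types (chi : A -> R[i]^o) (psi : B -> R[i]^o).

(** This is chi (x) psi when both are characters; [get] makes it total, with an arbitrary value if
    no such [F] exists. *)
Definition product_character chi psi : AB -> R[i]^o :=
  get [set F : AB -> R[i]^o | character F /\
    forall a b, F (tensor AB a b) = chi a * psi b].

Lemma product_characterP chi psi : character chi -> character psi ->
  character (product_character chi psi) /\
  forall a b, product_character chi psi (tensor AB a b) = chi a * psi b.
Proof.
move=> hchi hpsi.
have [F hF FE] := product_character_exists AB hchi hpsi.
by apply: (@getPex _ [set F : AB -> R[i]^o | character F /\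
    forall a b, F (tensor AB a b) = chi a * psi b]); exists F.
Qed.

Lemma character_tensor_eq (f g : AB -> R[i]^o) : character f -> character g ->
  (forall a b, f (tensor AB a b) = g (tensor AB a b)) -> f = g.
Proof.
move=> hf hg fg; apply: (character_span_eq (tensor_dense AB) hf hg).
by move=> _ /set_mem[a _ [b _ <-]].
Qed.

End product.

Arguments product_character {R A B} AB chi psi.

Section act.
Variables (R : realType) (A B : cstarAlgType R) (AB : minTensor A B).
Variables (d : A -> AB) (hd : unital_star_hom d).
Implicit Types (chi : A -> R[i]^o) (psi : B -> R[i]^o).

(** For a coaction [d] this is the right action of characters of [B] on those of [A]; for a
    comultiplication it is the convolution product. *)
Definition convolve chi psi : A -> R[i]^o := product_character AB chi psi \o d.

Lemma convolve_character chi psi : character chi -> character psi ->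
  character (convolve chi psi).
Proof.
move=> hchi hpsi; apply: unital_star_hom_comp hd.
by have [] := product_characterP AB hchi hpsi.
Qed.

(** chi (x) psi takes the value (convolve chi psi)(a) psi(b) at d(a)(1 (x) b). Such elements span a
    dense subspace, so the convolution and [psi] determine chi (x) psi, and with it [chi]. *)
Lemma convolve_injl chi chi' psi :
  closure (Defs.span [set d a * tensor AB 1 b | a in setT & b in setT]) = setT ->
  character chi -> character chi' -> character psi ->
  convolve chi psi = convolve chi' psi -> chi = chi'.
Proof.
move=> dense hchi hchi' hpsi E.
have [hF FE] := product_characterP AB hchi hpsi.
have [hF' FE'] := product_characterP AB hchi' hpsi.
have FF' : product_character AB chi psi = product_character AB chi' psi.
  apply: (character_span_eq dense hF hF') => _ /set_mem[a _ [b _ <-]].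
  rewrite (starhomM hF) (starhomM hF') FE FE'.
  rewrite -[product_character AB chi psi (d a)]/(convolve chi psi a) E.
  by rewrite (starhom1 hchi) (starhom1 hchi').
apply/funext => a; have := congr1 (fun F => F (tensor AB a 1)) FF'.
by rewrite FE FE' (starhom1 hpsi) !mulr1.
Qed.

End act.

(** The sides are P = (chi (x) psi) (x) psi' and Q = chi (x) (psi (x) psi'), evaluated on the two
    sides of coassociativity; it remains to match P and Q along [alpha]. With [delta] equal to
    [Delta] this is associativity of convolution. *)
Lemma convolveA (R : realType) (A H : cstarAlgType R) (AH : minTensor A H)
    (HH : minTensor H H) (AH_H : minTensor AH H) (A_HH : minTensor A HH)
    (delta : A -> AH) (Delta : H -> HH) (chi : A -> R[i]^o)
    (psi psi' : H -> R[i]^o) :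
  unital_star_hom delta -> unital_star_hom Delta ->
  coassociative AH_H A_HH delta Delta ->
  character chi -> character psi -> character psi' ->
  convolve delta (convolve delta chi psi) psi' =
  convolve delta chi (convolve Delta psi psi').
Proof.
move=> hdelta hDelta [did [idD [alpha [[hdid _ didE] [hidD _ idDE]]]]].
move=> [halpha _ alphaE] coassoc hchi hpsi hpsi'.
have [hF FE] := product_characterP AH hchi hpsi.
have [hG GE] := product_characterP HH hpsi hpsi'.
have hc := convolve_character hdelta hchi hpsi.
have hc' := convolve_character hDelta hpsi hpsi'.
have [hP PE] := product_characterP AH_H hF hpsi'.
have [hQ QE] := product_characterP A_HH hchi hG.
have [hL LE] := product_characterP AH hc hpsi'.
have [hM ME] := product_characterP AH hchi hc'.
set P := product_character AH_H _ _ in hP PE.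
set Q := product_character A_HH _ _ in hQ QE.
have L : P \o did = product_character AH (convolve delta chi psi) psi'.
  apply: character_tensor_eq => // [|a h]; first exact: unital_star_hom_comp.
  by rewrite /= didE PE LE.
have M : Q \o idD = product_character AH chi (convolve Delta psi psi').
  apply: character_tensor_eq => // [|a h]; first exact: unital_star_hom_comp.
  by rewrite /= idDE QE ME.
have hPa : character (P \o alpha) by exact: unital_star_hom_comp.
(* Elementary tensors [a (x) w] with [w] in [HH] reduce to those with
   [w = h (x) h'] because [w |-> P (alpha (1 (x) w))] is a character. *)
have P1 : P \o alpha \o tensor A_HH 1 = product_character HH psi psi'.
  apply: character_tensor_eq => // [|h h'].
    by apply: unital_star_hom_comp => //; exact: tensor1_hom.
  by rewrite /= alphaE PE FE GE (starhom1 hchi) mul1r.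
have PQ : P \o alpha = Q.
  apply: character_tensor_eq => // a w.
  rewrite -[in LHS](mulr1 a) -[in LHS](mul1r w) -tensorM (starhomM hPa).
  rewrite -[_ (tensor A_HH 1 w)]/((P \o alpha \o tensor A_HH 1) w) P1 QE.
  rewrite -(tensor1 HH) /= alphaE PE FE.
  by rewrite (starhom1 hpsi) (starhom1 hpsi') !mulr1.
rewrite /convolve -L -M -PQ.
apply/funext => a; exact: (congr1 (fun f => P (f a)) coassoc).
Qed.

(** * Compactness of the character space and continuity of convolution *)

Section character_space.
Variables (R : realType) (H : cstarAlgType R).
Notation X := [set psi : {ptws H -> R[i]^o} | character (psi : H -> R[i]^o)].

Lemma ptws_eval_continuous (h : H) :
  continuous (fun psi : {ptws H -> R[i]^o} => psi h : R[i]^o).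
Proof. exact: (@proj_continuous H (fun _ => R[i]^o) h). Qed.

Lemma character_space_closed : closed X.
Proof.
have cl (f g : {ptws H -> R[i]^o} -> R[i]^o) : continuous f -> continuous g ->
    (forall psi, X psi -> f psi = g psi) ->
    forall psi, closure X psi -> f psi = g psi.
  move=> cf cg fg psi clpsi; apply: (closed_coincidence cf cg).
  by apply: closureS clpsi => x /fg.
have ev := ptws_eval_continuous.
move=> psi clX; split=> [c x y||x y|x].
- apply: (cl (fun psi => psi (c *: x + y)) (fun psi => c *: psi x + psi y)
    _ _ _ _ clX) => //.
    by move=> f; exact: (cvgD (cvgZl_tmp (ev x f)) (ev y f)).
  by move=> f hf; exact: (starhom_linear (hf : character f)).
- apply: (cl (fun psi => psi 1) (fun=> 1) _ _ _ _ clX) => //.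
    exact: cst_continuous.
  by move=> f hf; exact: (starhom1 (hf : character f)).
- apply: (cl (fun psi => psi (x * y)) (fun psi => psi x * psi y) _ _ _ _ clX) => //.
    by move=> f; exact: (cvgM (ev x f) (ev y f)).
  by move=> f hf; exact: (starhomM (hf : character f)).
- apply: (cl (fun psi => psi (star x)) (fun psi => star (psi x)) _ _ _ _ clX) => //.
    exact: continuous_star (ev x).
  by move=> f hf; exact: (starhomS (hf : character f)).
Qed.

(** By [character_bound], characters form a closed subset of a product of discs, which is compact by
    Tychonoff. *)
Lemma character_space_compact : compact X.
Proof.
have ck : compact [set f : {ptws H -> R[i]^o} |
    forall h, [set z : R[i]^o | Normc.normc z <= 2 * cnorm h] (f h)].
  exact: (@tychonoff H (fun=> R[i]^o)
    (fun h => [set z | Normc.normc z <= 2 * cnorm h])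
    (fun h => @closed_disc_compact R (2 * cnorm h))).
apply: subclosed_compact character_space_closed ck _ => psi hpsi h.
exact: character_bound.
Qed.

Variables (HH : minTensor H H) (Delta : H -> HH).

(** Replace [Delta h] by a finite sum [s]: the error is uniform over all characters, and
    [tval psi y s] involves finitely many evaluations of [y]. Continuity is relative to the
    characters, since [product_character] is controlled only there. *)
Lemma convolve_continuous (psi : H -> R[i]^o) : character psi ->
  {within X, continuous
    (convolve Delta psi : {ptws H -> R[i]^o} -> {ptws H -> R[i]^o})}.
Proof.
move=> hpsi; apply: ptws_continuous => h.
apply/subspace_continuousP => x hx; apply/cvg_normcP => e e0.
(* The constant 2 of [character_bound] turns e/6 into e/3, and three such errors add up to e. *)
have e6 : 0 < e / 6 by rewrite divr_gt0.
have e3 : 0 < e / 3 by rewrite divr_gt0.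
have [s se] := tsum_dense (Delta h) e6.
have sE y : X y -> product_character HH psi y (tsum HH s) = tval psi y s.
  move=> hy; have [hF FE] := product_characterP HH hpsi hy.
  rewrite /tsum /tval; elim: (s) => [|p s' ih].
    by rewrite !big_nil (starhom0 hF).
  by rewrite !big_cons (starhomD hF) ih FE.
have approx y : X y -> Normc.normc (convolve Delta psi y h - tval psi y s) < e / 3.
  move=> hy; have [hF _] := product_characterP HH hpsi hy.
  rewrite -sE // -(starhomB hF); apply: le_lt_trans (character_bound hF _) _.
  by move: se; lra.
have cs : continuous (fun y : {ptws H -> R[i]^o} => tval psi y s).
  apply: continuous_sum_seq => p y.
  exact: (cvgMl_tmp (@ptws_eval_continuous p.2 y)).
have := (continuous_normcP _ x).1 (cs x) _ e3; rewrite /within /=.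
apply: filterS => y xy hy.
have -> : convolve Delta psi x h - convolve Delta psi y h =
   (convolve Delta psi x h - tval psi x s) + (tval psi x s - tval psi y s)
   - (convolve Delta psi y h - tval psi y s).
  by rewrite addrA subrK opprB addrA subrK.
have := normc_triangle ((convolve Delta psi x h - tval psi x s)
  + (tval psi x s - tval psi y s)) (- (convolve Delta psi y h - tval psi y s)).
have := normc_triangle (convolve Delta psi x h - tval psi x s)
  (tval psi x s - tval psi y s).
rewrite normcN; have := approx x hx; have := approx y hy; move: xy.
lra.
Qed.

End character_space.

Lemma convolution_idempotent (R : realType) (G : compactQuantumGroup R) :
  (exists psi : G -> R[i]^o, character psi) ->
  exists2 e : G -> R[i]^o, character e & convolve (@comul R G) e e = e.
Proof.
move=> [psi hpsi]; have hD := comul_hom G.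
apply: (@ellis_idempotent {ptws G -> R[i]^o}
  [set e | character (e : G -> R[i]^o)] (convolve (@comul R G))).
- by apply: (@hausdorff_product G (fun=> R[i]^o)) => _; exact: norm_hausdorff.
- exact: character_space_compact.
- by exists psi.
- by move=> x y; exact: convolve_character.
- by move=> x y z; apply: convolveA => //; exact: comul_coassoc.
- by move=> x; exact: convolve_continuous.
Qed.

(** With * for convolution, (chi * e) * e = chi * (e * e) = chi * e, and [e] cancels on the right by
    [convolve_injl]. So an idempotent acts as a counit would. *)
Lemma coaction_counit (R : realType) (A : cstarAlgType R)
    (G : compactQuantumGroup R) (delta : coaction A G) :
  (exists psi : G -> R[i]^o, character psi) ->
  exists2 e : G -> R[i]^o, character e &
    forall chi : A -> R[i]^o, character chi -> convolve delta chi e = chi.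
Proof.
move=> /convolution_idempotent[e he ee]; exists e => // chi hchi.
have hd := coact_hom delta.
apply: (convolve_injl (psi := e) (coact_counital delta)) => //; last first.
  rewrite (convolveA hd (comul_hom G) (coact_coassoc delta)) //.
  by rewrite ee.
exact: convolve_character.
Qed.

Theorem corollary4p8 (R : realType) (H : compactQuantumGroup R)
    (A : cstarAlgType R) (delta : coaction A H)
    (delta_free : free_coaction delta)
    (phi : join delta -> R[i]^o) (phi_char : character phi) :
  [/\ (exists chi : A -> R[i]^o, character chi) \/
      (exists chi : H -> R[i]^o, character chi),
      (exists chi : H -> R[i]^o, character chi) ->
        exists2 rho : C_tensor_H delta -> R[i]^o, character rho &
          character_path phi (rho \o @ev1 R A H delta) &
      (exists chi : A -> R[i]^o, character chi) ->
        exists2 rho : deltaA delta -> R[i]^o, character rho &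
          character_path phi (rho \o @ev0 R A H delta)].
Proof.
have hd := coact_hom delta.
have h1 := tensor1_hom (coact_AH delta).
pose dA (a : A) : deltaA delta := exist _ (delta a) (mem_set (imageT delta a)).
pose dH (h : H) : C_tensor_H delta :=
  exist _ (tensor (coact_AH delta) 1 h) (mem_set (imageT _ h)).
have hdA : unital_star_hom dA.
  split=> [c x y||x y|x]; apply: val_inj.
  - by rewrite linearP; exact: (starhom_linear hd).
  - by rewrite rmorph1; exact: (starhom1 hd).
  - by rewrite rmorphM; exact: (starhomM hd).
  - exact: (starhomS hd).
have hdH : unital_star_hom dH.
  split=> [c x y||x y|x]; apply: val_inj.
  - by rewrite linearP; exact: (starhom_linear h1).
  - by rewrite rmorph1; exact: (starhom1 h1).
  - by rewrite rmorphM; exact: (starhomM h1).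
  - exact: (starhomS h1).
have dA_surj x : exists a, dA a = x.
  by have [a _ aE] := set_mem (valP x); exists a; apply: val_inj.
have dH_surj x : exists h, dH h = x.
  by have [h _ hE] := set_mem (valP x); exists h; apply: val_inj.
have hvalA := starsub_val_hom (deltaA delta).
have hvalH := starsub_val_hom (C_tensor_H delta).
have [[rho hrho phiE]|[rho hrho phiE]|[t [rho hrho phiE]]] :=
  join_character_fiber phi_char.
- have hchi : character (rho \o dA) by exact: unital_star_hom_comp.
  split; first by left; exists (rho \o dA).
  + move=> /(coaction_counit delta)[e he eP].
    (* [F] extends [rho] from delta(A) to A (x) H: F(delta(a)) is the convolution of [rho \o dA]
       with [e] at a, which [eP] identifies with rho(delta(a)). The evaluation point can then leave
       0. *)
    have [hF FE] := product_characterP (coact_AH delta) hchi he.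
    set F := product_character _ _ _ in hF FE.
    exists (F \o \val); first exact: unital_star_hom_comp.
    suff -> : phi = F \o ev_at I0 by exact: ev_at_path.
    apply/funext => f; rewrite phiE /=; have [a aE] := dA_surj (ev0 f).
    rewrite -aE -[LHS]/((rho \o dA) a) -(eP _ hchi).
    by rewrite /ev_at -[\val f I0]/(\val (ev0 f)) -aE.
  + by move=> _; exists rho => //; rewrite -phiE; exact: constant_path.
- have hpsi : character (rho \o dH) by exact: unital_star_hom_comp.
  split; first by right; exists (rho \o dH).
  + by move=> _; exists rho => //; rewrite -phiE; exact: constant_path.
  + move=> [chi hchi].
    (* [F] extends [rho] from C (x) H to A (x) H, because F(1 (x) h) = chi(1) rho(1 (x) h). *)
    have [hF FE] := product_characterP (coact_AH delta) hchi hpsi.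
    set F := product_character _ _ _ in hF FE.
    exists (F \o \val); first exact: unital_star_hom_comp.
    suff -> : phi = F \o ev_at I1 by exact: ev_at_path.
    apply/funext => f; rewrite phiE /=; have [h hE] := dH_surj (ev1 f).
    rewrite -hE /ev_at -[\val f I1]/(\val (ev1 f)) -hE.
    by rewrite -[\val (dH h)]/(tensor (coact_AH delta) 1 h) FE (starhom1 hchi) mul1r.
(* Here [rho] is defined on all of A (x) H, so the evaluation point can move to either endpoint. *)
- split; first by left; exists (rho \o delta); exact: unital_star_hom_comp.
  + move=> _; exists (rho \o \val); first exact: unital_star_hom_comp.
    by rewrite phiE; exact: ev_at_path.
  + move=> _; exists (rho \o \val); first exact: unital_star_hom_comp.
    by rewrite phiE; exact: ev_at_path.
Qed.
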